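(* Let $\ell>0$. Assume that $M>4\sqrt{N}$. Then, irrespectively of the distribution of $(\mathbf{X},Y)$ and of the estimators $\hat f$ and $\tilde\sigma^2$, $$\mathbb{E}\left[\left|\mathcal{L}(\hat\Gamma)-\ell\right|\right]\leq C\frac{s}{\sqrt{N}},$$ where $C>0$ is an absolute constant.
   Context: Data: $(\mathbf{X},Y)$ is a random pair in $\mathbb{R}^d\times\mathbb{R}$. $\mathcal{D}_n=\{(\mathbf{X}_i,Y_i)\}_{i=1}^n$ is a labeled sample of i.i.d. copies of $(\mathbf{X},Y)$, and $\mathcal{D}_N=\{\mathbf{X}_{n+1},\dots,\mathbf{X}_{n+N}\}$ is an unlabeled sample of i.i.d. copies of $\mathbf{X}$ independent of $\mathcal{D}_n$. Let $\hat f:\mathbb{R}^d\to\mathbb{R}$ and $\tilde\sigma^2:\mathbb{R}^d\to[0,\infty)$ be estimators (of the regression function and of the conditional variance function) built from $\mathcal{D}_n$ by any algorithm. For $s>0$ define $$\hat\sigma^2(\mathbf{x})=\tilde\sigma^2(\mathbf{x})\mathbf{1}_{\{s^{-1}\leq\tilde\sigma^2(\mathbf{x})\leq s\}}+s^{-1}\mathbf{1}_{\{\tilde\sigma^2(\mathbf{x})<s^{-1}\}}+s\mathbf{1}_{\{\tilde\sigma^2(\mathbf{x})>s\}},$$ $$\hat p(y|\mathbf{x})=\frac{1}{\sqrt{2\pi}\hat\sigma(\mathbf{x})}\exp\left(-\frac{(y-\hat f(\mathbf{x}))^2}{2\hat\sigma^2(\mathbf{x})}\right)\mathbf{1}_{\{|y|\leq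 s\}}.$$ Let $\zeta$ be uniform on $[0,u]$, $u>0$, independent of $(\mathbf{X},Y)$ and of the samples, and let $\zeta_1,\dots,\zeta_N$ be i.i.d. copies of $\zeta$, independent of everything else. Set $\hat p(y|\mathbf{x},z)=\hat p(y|\mathbf{x})+z\mathbf{1}_{\{|y|\leq s\}}$. Let $\{y_1,\dots,y_M\}$, $M\geq1$, be the regular (equally spaced) grid of $[-s,s]$, and put $$\hat G(t)=\frac{2s}{MN}\sum_{k=1}^M\sum_{i=1}^N\mathbf{1}_{\{\hat p(y_k|\mathbf{X}_{n+i},\zeta_i)>t\}},$$ with generalized inverse $\hat G^{-1}(\ell)=\inf\{t\geq0:\hat G(t)\leq\ell\}$. The empirical prediction interval is $\hat\Gamma(\mathbf{X},\zeta)=\{y\in\mathbb{R}:\hat p(y|\mathbf{X},\zeta)\geq\hat G^{-1}(\ell)\}$. Its expected length is $\mathcal{L}(\hat\Gamma)=\mathbb{E}_{\mathbf{X},\zeta}[L(\hat\Gamma(\mathbf{X},\zeta))]$, with $L$ Lebesgue measure, where the expectation is over a fresh $(\mathbf{X},\zeta)$ only, conditionally on $\mathcal{D}_n,\mathcal{D}_N,\zeta_1,\dots,\zeta_N$. The outer $\mathbb{E}$ averages over the samples.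
   Formalization: The formal theorem assumes ℓ<2s: for ℓ≥2s one has Ĝ⁻¹(ℓ)=0, so Γ̂ is all of ℝ with infinite length and the bound fails. It also takes N≥1 and estimators that are measurable functions of the labeled sample and x. *)

(* Defs.v *)
From HB Require Import structures.
From mathcomp Require Import all_boot all_order all_algebra.
From mathcomp Require Import all_classical all_reals all_analysis.
Set Implicit Arguments.
Unset Strict Implicit.
Unset Printing Implicit Defensive.
Import Order.TTheory GRing.Theory Num.Theory.
Import numFieldNormedType.Exports.
Local Open Scope classical_set_scope.
Local Open Scope ring_scope.

Definition mutually_independent (disp : measure_display)
    (Omega : measurableType disp) (R : realType) (P : probability Omega R)
    (I : finType) (F : I -> set (set Omega)) : Prop :=
  forall (J : {set I}) (E : I -> set Omega),
    (forall i, i \in J -> F i (E i)) ->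
    P (\bigcap_(i in [set` J]) E i) = (\prod_(i in J) P (E i))%E.

Definition same_law (disp disp' : measure_display)
    (Omega : measurableType disp) (T : measurableType disp') (R : realType)
    (P : probability Omega R) (X Y : Omega -> T) : Prop :=
  forall A : set T, measurable A -> pushforward P X A = pushforward P Y A.

(* Points of R^d are d-tuples, with the product Borel sigma-algebra.
   The sigma-algebras of the fresh pair (X, Y), the fresh zeta, the labeled
   pairs (X_i, Y_i), the unlabeled features X_{n+j} and the zeta_j, as a single
   family indexed by a finite type. *)
Definition data_sigma (R : realType) (disp : measure_display)
    (Omega : measurableType disp) (d n N : nat)
    (XY : Omega -> d.-tuple R * R) (zeta : Omega -> R)
    (D : 'I_n -> Omega -> d.-tuple R * R)
    (XN : 'I_N -> Omega -> d.-tuple R) (zetaN : 'I_N -> Omega -> R)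
    (i : (unit + unit + 'I_n + 'I_N + 'I_N)%type) : set (set Omega) :=
  match i with
  | inl (inl (inl (inl _))) => g_sigma_algebra_preimage XY
  | inl (inl (inl (inr _))) => g_sigma_algebra_preimage zeta
  | inl (inl (inr i)) => g_sigma_algebra_preimage (D i)
  | inl (inr j) => g_sigma_algebra_preimage (XN j)
  | inr j => g_sigma_algebra_preimage (zetaN j)
  end.

(* A sum of indicators, not a clamp: the two differ when s < 1. *)
Definition sigma2_hat (R : realType) (d : nat) (s : R)
    (sigma2_tilde : d.-tuple R -> R) (x : d.-tuple R) : R :=
  sigma2_tilde x * (s^-1 <= sigma2_tilde x <= s)%R%:R
  + s^-1 * (sigma2_tilde x < s^-1)%R%:R
  + s * (s < sigma2_tilde x)%R%:R.

Definition p_hat (R : realType) (d : nat) (s : R)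
    (f sigma2_tilde : d.-tuple R -> R) (y : R) (x : d.-tuple R) : R :=
  (Num.sqrt (2 * pi) * Num.sqrt (sigma2_hat s sigma2_tilde x))^-1
  * expR (- ((y - f x) ^+ 2 / (2 * sigma2_hat s sigma2_tilde x)))
  * (`|y| <= s)%R%:R.

Definition p_hat_rand (R : realType) (d : nat) (s : R)
    (f sigma2_tilde : d.-tuple R -> R) (y : R) (x : d.-tuple R) (z : R) : R :=
  p_hat s f sigma2_tilde y x + z * (`|y| <= s)%R%:R.

(* Both endpoints -s and s are grid points when 2 <= M. *)
Definition grid (R : realType) (s : R) (M : nat) (k : 'I_M) : R :=
  - s + 2 * s * k%:R / M.-1%:R.

Definition G_hat (R : realType) (d : nat) (s : R) (M N : nat)
    (f sigma2_tilde : d.-tuple R -> R)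
    (x : 'I_N -> d.-tuple R) (z : 'I_N -> R) (t : R) : R :=
  2 * s / (M%:R * N%:R)
  * \sum_(k < M) \sum_(i < N)
      (t < p_hat_rand s f sigma2_tilde (grid s k) (x i) (z i))%R%:R.

Definition generalized_inverse (R : realType) (G : R -> R) (l : R) : R :=
  inf [set t | 0 <= t /\ G t <= l].

Definition Gamma_hat (R : realType) (d : nat) (s : R) (M N : nat)
    (f sigma2_tilde : d.-tuple R -> R)
    (x : 'I_N -> d.-tuple R) (z : 'I_N -> R) (l : R)
    (x0 : d.-tuple R) (z0 : R) : set R :=
  [set y | generalized_inverse (G_hat s M f sigma2_tilde x z) l
           <= p_hat_rand s f sigma2_tilde y x0 z0].

(* The expected length of a set-valued map [Gamma], over (X, zeta) only.  For
   [Gamma] depending on samples independent of (X, zeta), frozen at their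
   values, this is the conditional expectation given the samples. *)
Definition expected_length (R : realType) (disp : measure_display)
    (Omega : measurableType disp) (P : probability Omega R) (d : nat)
    (X : Omega -> d.-tuple R) (zeta : Omega -> R)
    (Gamma : d.-tuple R -> R -> set R) : \bar R :=
  (\int[P]_w (@lebesgue_measure R (Gamma (X w) (zeta w))))%E.

(* Main.v *)
Require Import Defs.
From HB Require Import structures.
From mathcomp Require Import all_boot all_order all_algebra.
From mathcomp Require Import all_classical all_reals all_analysis.
From mathcomp Require Import measurable_realfun ring lra.
Set Implicit Arguments.
Unset Strict Implicit.
Unset Printing Implicit Defensive.
Import Order.TTheory GRing.Theory Num.Theory.
Import numFieldNormedType.Exports.
Local Open Scope classical_set_scope.
Local Open Scope ring_scope.

(** Write [m t] for the expected length, over a fresh pair [(X, zeta)] and given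
    the labeled sample, of the region where the randomized density exceeds [t].
    The uniform noise makes [m] Lipschitz on the nonnegative half-line
    ([mean_superlevel_length_lipschitz]), with [m 0 = 2s] and [m t = 0] for
    large [t].  Hence every level [v] in ]0, 2s[ is attained, at a threshold
    [level v] that depends measurably on the labeled sample alone
    ([level_spec], [measurable_level]), and the length of the prediction
    interval with empirical threshold [t0] is [m t0]
    ([expected_length_mean_length]); [t0] is positive almost surely because
    [l < 2s] ([G_hat_quantile_gt0]).

    The empirical threshold is compared with the thresholds of nearby levels.
    If [m t0 > l + a], then [t0] is smaller than the threshold of level [l + a],
    so that the empirical length there is at most [l], although its conditional
    mean is [l + a] up to the discretization of the grid; the case
    [m t0 < l - a] is symmetric ([level_deviation_large]).  The superlevel
    regions are intervals, so the grid costs at most a constant times [s / M]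
    ([grid_count]), which is of order [s / sqrt N] as [M > 4 sqrt N].

    Given the labeled sample, the threshold of a fixed level is a constant, and
    the empirical length there is a mean of [N] independent variables in
    [0, 2s]: its second moment around [v] is at most [(2s)^2 / N]
    ([level_second_moment]).  Its proof rests on the decoupling of independent
    groups ([integral_independent2], [joint_events_independent]).  Chebyshev's
    inequality at the levels [l + a] and [l - a], for [a] ranging over the
    dyadic multiples of [4s / sqrt N], sums to a geometric series
    ([dyadic_bound], [dyadic_integral]) and yields the constant [20]. *)

(** * Integral domination and independent pairs *)

Section nonmeasurable_domination.
Local Open Scope ereal_scope.
Context d (T : measurableType d) (R : realType).
Variable mu : {measure set T -> \bar R}.

(** The integral of a nonnegative function is a supremum over the simple
    functions below it, hence monotone on all nonnegative functions.  This
    covers the error of the prediction interval as a function of the samples,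
    and measures of sets that vary with the integration variable. *)
Lemma ge0_le_integral_nonmeasurable (f g : T -> \bar R) :
  (forall x, 0 <= f x) -> (forall x, f x <= g x) ->
  \int[mu]_x f x <= \int[mu]_x g x.
Proof.
move=> f0 fg; have g0 x : 0 <= g x by exact: le_trans (fg x).
rewrite !ge0_integralTE//; apply: le_ereal_sup => _ [h hf <-].
by exists h => // x; exact: le_trans (fg x).
Qed.

(** The majorant [g] is raised to [+oo] on the null set [A], which leaves its
    integral unchanged. *)
Lemma ge0_le_integral_off_null (f g : T -> \bar R) (A : set T) :
  measurable A -> mu A = 0 -> measurable_fun [set: T] g ->
  (forall x, 0 <= f x) -> (forall x, 0 <= g x) ->
  (forall x, ~ A x -> f x <= g x) ->
  \int[mu]_x f x <= \int[mu]_x g x.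
Proof.
move=> mA A0 mg f0 g0 fg.
pose h x := g x + +oo * (\1_A x)%:E.
have mi : measurable_fun [set: T] (fun x => +oo * (\1_A x)%:E : \bar R).
  by apply: emeasurable_funM => //; apply/measurable_EFinP; exact: measurable_indic.
have i0 x : 0 <= +oo * (\1_A x)%:E :> \bar R by rewrite mule_ge0// lee_fin.
apply: (@le_trans _ _ (\int[mu]_x h x)).
  apply: ge0_le_integral_nonmeasurable => // x; rewrite /h.
  have [Ax|nAx] := pselect (A x).
    by rewrite indicE mem_set// mule1 addey ?leey// -ltNye (lt_le_trans _ (g0 x)) ?ltNyr.
  by rewrite indicE memNset//= mule0 adde0; exact: fg.
rewrite /h ge0_integralD//.
rewrite [X in _ + X](_ : _ = 0) ?adde0//.
rewrite ge0_integralZl//=.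
- by rewrite integral_indic// setIT A0 mule0.
- by apply/measurable_EFinP; exact: measurable_indic.
Qed.

End nonmeasurable_domination.

Lemma measurable_fun_section1 d1 d2 d3 (T1 : measurableType d1)
    (T2 : measurableType d2) (T3 : measurableType d3) (phi : T1 -> T2 -> T3) :
  measurable_fun setT (fun q : T1 * T2 => phi q.1 q.2) ->
  forall a, measurable_fun setT (phi a).
Proof.
move=> mphi a.
have mpair : measurable_fun setT (fun b : T2 => (a, b)).
  by apply: measurable_fun_pair => //; exact: measurable_cst.
have := measurableT_comp mphi mpair; apply: eq_measurable_fun.
by move=> b _.
Qed.

Section independence.
Context (R : realType) (disp : measure_display) (Omega : measurableType disp).
Variable P : probability Omega R.

Definition independent2 d1 d2 (T1 : measurableType d1) (T2 : measurableType d2)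
    (A : Omega -> T1) (B : Omega -> T2) : Prop :=
  forall U V, measurable U -> measurable V ->
    P (A @^-1` U `&` B @^-1` V) = (P (A @^-1` U) * P (B @^-1` V))%E.

(** Decoupling: the law of an independent pair is the product of the marginal
    laws, because both agree on rectangles; Tonelli then separates the two
    sources of randomness, and both integrals can be read on [Omega]. *)
Lemma integral_independent2 d1 d2 (T1 : measurableType d1)
    (T2 : measurableType d2) (A : Omega -> T1) (B : Omega -> T2)
    (phi : T1 -> T2 -> \bar R) :
  measurable_fun setT A -> measurable_fun setT B -> independent2 A B ->
  measurable_fun setT (fun q : T1 * T2 => phi q.1 q.2) ->
  (forall a b, 0 <= phi a b)%E ->
  (\int[P]_w phi (A w) (B w) = \int[P]_w \int[P]_w' phi (A w) (B w'))%E.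
Proof.
move=> mA mB indAB mphi phi0.
pose fA : {mfun Omega >-> T1} := mfun_Sub (mem_set mA).
pose fB : {mfun Omega >-> T2} := mfun_Sub (mem_set mB).
pose AB w := (A w, B w).
have mAB : measurable_fun setT AB by exact: measurable_fun_pair.
pose fAB : {mfun Omega >-> (T1 * T2)%type} := mfun_Sub (mem_set mAB).
have -> : (\int[P]_w phi (A w) (B w))%E =
    (\int[distribution P fAB]_q phi q.1 q.2)%E.
  by rewrite ge0_integral_distribution.
transitivity (\int[distribution P fA \x distribution P fB]_q phi q.1 q.2)%E.
  apply: eq_measure_integral => X mX _; apply/esym.
  by apply: product_measure_unique.
rewrite fubini_tonelli1//.
rewrite ge0_integral_distribution//; last 2 first.
- exact: measurable_fun_fubini_tonelli_F.
- by move=> a; apply: integral_ge0 => b _; exact: phi0.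
apply: eq_integral => w _; rewrite /fubini_F /=.
rewrite ge0_integral_distribution//=.
exact: measurable_fun_section1.
Qed.

Lemma integral_same_law d1 (T1 : measurableType d1) (A B : Omega -> T1)
    (phi : T1 -> \bar R) :
  measurable_fun setT A -> measurable_fun setT B -> same_law P A B ->
  measurable_fun setT phi -> (forall a, 0 <= phi a)%E ->
  (\int[P]_w phi (A w) = \int[P]_w phi (B w))%E.
Proof.
move=> mA mB AB mphi phi0.
pose fA : {mfun Omega >-> T1} := mfun_Sub (mem_set mA).
pose fB : {mfun Omega >-> T1} := mfun_Sub (mem_set mB).
transitivity (\int[distribution P fA]_q phi q)%E.
  by rewrite ge0_integral_distribution.
rewrite (eq_measure_integral (distribution P fB)); last first.
  by move=> X mX _; exact: AB.
by rewrite ge0_integral_distribution.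
Qed.

(** Once the pairs are decoupled, the coordinates can be exchanged one at a
    time. *)
Lemma same_law_pair d1 d2 (T1 : measurableType d1) (T2 : measurableType d2)
    (A A' : Omega -> T1) (B B' : Omega -> T2) :
  measurable_fun setT A -> measurable_fun setT A' ->
  measurable_fun setT B -> measurable_fun setT B' ->
  independent2 A B -> independent2 A' B' ->
  same_law P A A' -> same_law P B B' ->
  same_law P (fun w => (A w, B w)) (fun w => (A' w, B' w)).
Proof.
move=> mA mA' mB mB' AB AB' lA lB X mX.
pose phi a b : \bar R := (\1_X (a, b))%:E.
have mphi : measurable_fun setT (fun q : T1 * T2 => phi q.1 q.2).
  apply/measurable_EFinP; rewrite (_ : (fun _ => _) = \1_X).
    exact: measurable_indic.
  by apply/funext => -[].
have phi0 a b : (0 <= phi a b)%E by rewrite lee_fin.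
have E (f : Omega -> T1) (g : Omega -> T2) : measurable_fun setT f ->
    measurable_fun setT g -> pushforward P (fun w => (f w, g w)) X =
    (\int[P]_w phi (f w) (g w))%E.
  move=> mf mg; rewrite /pushforward.
  have mfg : measurable ((fun w => (f w, g w)) @^-1` X).
    by rewrite -[X in measurable X]setTI; apply: measurable_fun_pair.
  by rewrite -[X in P X]setIT -integral_indic.
rewrite (E A B)// (E A' B')//.
rewrite (integral_independent2 mA mB AB mphi phi0).
rewrite (integral_independent2 mA' mB' AB' mphi phi0).
transitivity (\int[P]_w \int[P]_w' phi (A w) (B' w'))%E.
  apply: eq_integral => w _; apply: (integral_same_law (phi := phi (A w))) => //.
  exact: measurable_fun_section1.
pose psi a := (\int[P]_w' phi a (B' w'))%E.
apply: (integral_same_law (phi := psi)) => //; last first.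
  by move=> a; exact: integral_ge0.
apply: (@measurable_fun_fubini_tonelli_F _ _ _ _ _ _
  (fun q : T1 * Omega => phi q.1 (B' q.2))) => //=.
have mpair : measurable_fun setT (fun q : T1 * Omega => (q.1, B' q.2)).
  by apply: measurable_fun_pair => //; exact: measurableT_comp.
exact: measurableT_comp mphi mpair.
Qed.

End independence.

(** * Independence of groups of sigma-algebras *)

Section grouping.
Context (R : realType) (disp : measure_display) (Omega : measurableType disp).
Variable P : probability Omega R.

(** The finite measures [A |-> P (A `&` B)] and [A |-> P A * P B] agree on the
    pi-system [G], hence on the sigma-algebra that it generates. *)
Lemma independent_g_sigma_algebra (G : set (set Omega)) (B : set Omega) :
  G `<=` measurable -> setI_closed G -> G setT -> measurable B ->
  (forall A, G A -> P (A `&` B) = (P A * P B)%E) ->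
  forall A, <<s G >> A -> P (A `&` B) = (P A * P B)%E.
Proof.
move=> Gm GI GT mB indG A sGA.
have PB0 : 0 <= fine (P B) by rewrite fine_ge0.
pose m1 := mrestr P mB.
pose m2 := mscale (NngNum PB0) P.
have m2E X : m2 X = (P X * P B)%E.
  by rewrite /m2 /mscale/= fineK ?fin_num_measure// muleC.
rewrite -m2E -[LHS]/(m1 A).
apply: (g_sigma_algebra_measure_unique G Gm (fun=> setT)) => //.
- by rewrite bigcup_const.
- by move=> X GX; rewrite [RHS]m2E; exact: indG.
- by move=> _; rewrite /= /mrestr (le_lt_trans (probability_le1 P _)) ?ltry ?setTI.
Qed.

Context (I : finType) (F : I -> set (set Omega)).

(** Intersections of one event from each sigma-algebra indexed by [J]: a
    pi-system that generates the sigma-algebra of the group [J].  The family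
    [E] is total, so that two of them can be glued along disjoint groups. *)
Definition joint_events (J : {set I}) : set (set Omega) :=
  [set A | exists2 E : I -> set Omega,
     (forall i, F i (E i)) & A = \bigcap_(i in [set` J]) E i].

Hypothesis Fm : forall i, F i `<=` measurable.
Hypothesis FI : forall i, setI_closed (F i).
Hypothesis FT : forall i, F i setT.
Hypothesis indF : mutually_independent P F.

Lemma joint_events_measurable J : joint_events J `<=` measurable.
Proof.
move=> _ [E FE ->]; apply: fin_bigcap_measurable; first exact: finite_finset.
by move=> i _; exact: Fm.
Qed.

Lemma joint_events_setI J : setI_closed (joint_events J).
Proof.
move=> _ _ [E FE ->] [E' FE' ->]; exists (fun i => E i `&` E' i).
  by move=> i; exact: FI.
by rewrite bigcapI.
Qed.

Lemma joint_eventsT J : joint_events J setT.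
Proof. by exists (fun=> setT) => //; rewrite bigcapT. Qed.

Lemma joint_events_coord (J : {set I}) i A :
  i \in J -> F i A -> joint_events J A.
Proof.
move=> iJ FA; exists (fun j => if j == i then A else setT).
  by move=> j; case: eqP => [->|].
apply/seteqP; split => [w Aw j _|w /(_ i iJ)]; last by rewrite eqxx.
by case: ifP.
Qed.

(** Grouping: on the two pi-systems independence is the product rule for the
    glued family, and it passes to the generated sigma-algebras one side at a
    time. *)
Lemma joint_events_independent (J K : {set I}) A B : [disjoint J & K]%B ->
  <<s joint_events J >> A -> <<s joint_events K >> B ->
  P (A `&` B) = (P A * P B)%E.
Proof.
move=> JK sA sB.
have sm L : <<s joint_events L >> `<=` measurable.
  by apply: smallest_sub; [exact: sigma_algebra_measurable|
    exact: joint_events_measurable].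
apply: (independent_g_sigma_algebra (G := joint_events J)) => //.
- exact: joint_events_measurable.
- exact: joint_events_setI.
- exact: joint_eventsT.
- exact: sm sB.
move=> {sA}A jA; rewrite setIC muleC.
apply: (independent_g_sigma_algebra (G := joint_events K)) => //.
- exact: joint_events_measurable.
- exact: joint_events_setI.
- exact: joint_eventsT.
- exact: joint_events_measurable jA.
move=> {sB}B [E' FE' ->]; case: jA => E FE ->.
pose E2 i := if i \in J then E i else E' i.
have FE2 i : F i (E2 i) by rewrite /E2; case: ifP.
have EE2 i : i \in J -> E2 i = E i by rewrite /E2 => ->.
have E'E2 i : i \in K -> E2 i = E' i.
  by rewrite /E2; case: ifPn => // iJ; rewrite (disjointFr JK).
have -> : \bigcap_(i in [set` J]) E i = \bigcap_(i in [set` J]) E2 i.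
  by apply: eq_bigcapr => i /= iJ; rewrite EE2.
have -> : \bigcap_(i in [set` K]) E' i = \bigcap_(i in [set` K]) E2 i.
  by apply: eq_bigcapr => i /= iK; rewrite E'E2.
rewrite -bigcap_setU.
have -> : [set` K] `|` [set` J] = [set` K :|: J].
  by apply/seteqP; split => i /=; rewrite inE => /orP.
rewrite !indF// muleC -bigU//=.
by apply: eq_bigl => i; rewrite !inE orbC.
Qed.

Lemma independent_joint_functions (J K : {set I}) d1 d2
    (T1 : measurableType d1) (T2 : measurableType d2)
    (f : Omega -> T1) (g : Omega -> T2) : [disjoint J & K]%B ->
  measurable_fun (setT : set (g_sigma_algebraType (joint_events J))) f ->
  measurable_fun (setT : set (g_sigma_algebraType (joint_events K))) g ->
  independent2 P f g.
Proof.
move=> JK mf mg U V mU mV; apply: (joint_events_independent JK).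
- by rewrite -[X in <<s _ >> X]setTI; exact: mf.
- by rewrite -[X in <<s _ >> X]setTI; exact: mg.
Qed.

Lemma measurable_joint_coord (J : {set I}) i d1 (T1 : measurableType d1)
    (f : Omega -> T1) :
  i \in J -> (forall U, measurable U -> F i (f @^-1` U)) ->
  measurable_fun (setT : set (g_sigma_algebraType (joint_events J))) f.
Proof.
move=> iJ fF _ U mU; rewrite setTI; apply: sub_sigma_algebra.
by apply: (joint_events_coord iJ); exact: fF.
Qed.

End grouping.

(** * Generalized inverses, dyadic levels and grid counting *)

Section generalized_inverse_facts.
Context (R : realType).
Implicit Types (g : R -> R) (v t : R).

Lemma generalized_inverse_le g v t :
  0 <= t -> g t <= v -> generalized_inverse g v <= t.
Proof. by move=> t0 gt; apply: ge_inf; [exists 0 => x []|]. Qed.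

Lemma generalized_inverse_gt g v t :
  (exists2 t0, 0 <= t0 & g t0 <= v) ->
  (forall r r', 0 <= r -> r <= r' -> g r' <= g r) ->
  generalized_inverse g v < t -> g t <= v.
Proof.
move=> [t0 t00 gt0] gnon gt.
have [] := @inf_lt R [set t | 0 <= t /\ g t <= v] t _ gt.
  by exists t0.
by move=> r [r0 gr] rt; apply: le_trans gr; apply: gnon => //; exact: ltW.
Qed.

(** Continuity makes the generalized inverse a true inverse: the level [v] is
    attained at it.  It also satisfies a Galois connection with [g], from which
    its measurability in a parameter will follow. *)
Lemma generalized_inverse_lipschitz g K v :
  0 <= K -> (forall r t, 0 <= r -> r <= t -> g t <= g r) ->
  (forall r t, 0 <= r -> r <= t -> g r <= g t + K * (t - r)) ->
  v <= g 0 -> (exists2 t, 0 <= t & g t <= v) ->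
  [/\ 0 <= generalized_inverse g v, g (generalized_inverse g v) = v &
      forall c, 0 <= c -> (c < generalized_inverse g v) = (v < g c)].
Proof.
move=> K0 gnon glip vg0 [t1 t10 gt1].
set tau := generalized_inverse g v.
have tau0 : 0 <= tau by apply: lb_le_inf; [exists t1|move=> x []].
have K1 : 0 < K + 1 by rewrite ltr_wpDl.
have gtau : g tau = v.
  apply/eqP; rewrite eq_le; apply/andP; split; apply/ler_addgt0Pr => e e0.
    have [] := @inf_lt R [set t | 0 <= t /\ g t <= v] (tau + e / (K + 1)).
    - by exists t1.
    - by rewrite ltrDl divr_gt0.
    move=> r [r0 gr] rlt.
    have taur : tau <= r by exact: generalized_inverse_le.
    apply: (le_trans (glip _ _ tau0 taur)); apply: lerD => //.
    apply: (@le_trans _ _ (K * (e / (K + 1)))).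
      by rewrite ler_wpM2l// lerBlDl ltW.
    by rewrite mulrCA ger_pMr// ler_pdivrMr// mul1r lerDl.
  have [tau_eq0|tau_neq0] := eqVneq tau 0.
    by rewrite tau_eq0 (le_trans vg0)// lerDl ltW.
  pose r := Num.max 0 (tau - e / (K + 1)).
  have r0 : 0 <= r by rewrite le_max lexx.
  have rtau : r < tau.
    by rewrite gt_max lt_neqAle eq_sym tau_neq0 tau0/= ltrBlDr ltrDl divr_gt0.
  have vgr : v <= g r.
    rewrite leNgt; apply/negP => /ltW gr.
    by have := generalized_inverse_le r0 gr; rewrite leNgt rtau.
  apply: (le_trans vgr); apply: (le_trans (glip _ _ r0 (ltW rtau))).
  rewrite lerD2l; apply: (@le_trans _ _ (K * (e / (K + 1)))).
    by rewrite ler_wpM2l// lerBlDr -lerBlDl le_max lexx orbT.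
  by rewrite mulrCA ger_pMr// ler_pdivrMr// mul1r lerDl.
split=> // c c0; apply/idP/idP => [ctau|vgc].
  by rewrite ltNge; apply/negP => /(generalized_inverse_le c0); rewrite leNgt ctau.
rewrite ltNge; apply/negP => tauc.
by have := gnon _ _ tau0 tauc; rewrite gtau leNgt vgc.
Qed.

End generalized_inverse_facts.

Section dyadic.
Context (R : realType).

(** A layer-cake bound along dyadic levels: between two consecutive levels
    [x] grows by at most the lower one, and [q j >= 1] pays for that step. *)
Lemma dyadic_bound (delta x : R) (q : nat -> R) (J : nat) :
  0 <= delta -> (forall j, 0 <= q j) ->
  (forall j, delta * 2 ^+ j < x -> 1 <= q j) -> x <= delta * 2 ^+ J ->
  x <= delta + \sum_(j < J) delta * 2 ^+ j * q j.
Proof.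
move=> d0 q0 q1 xJ.
suff : Num.min x (delta * 2 ^+ J) <= delta + \sum_(j < J) delta * 2 ^+ j * q j.
  by rewrite min_l.
elim: J {xJ} => [|J IH]; first by rewrite big_ord0 addr0 expr0 mulr1 ge_min lexx orbT.
rewrite big_ord_recr/= addrA.
have dJ0 : 0 <= delta * 2 ^+ J by rewrite mulr_ge0// exprn_ge0.
have [xJ|Jx] := leP x (delta * 2 ^+ J).
  have IH' : x <= delta + \sum_(j < J) delta * 2 ^+ j * q j by rewrite (min_l xJ) in IH.
  rewrite ge_min; apply/orP; left; apply: (le_trans IH').
  by rewrite lerDl mulr_ge0.
rewrite ge_min; apply/orP; right.
rewrite (min_r (ltW Jx)) in IH.
rewrite exprS mulrCA mulr_natl mulr2n; apply: lerD => //.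
by rewrite ler_peMr// q1.
Qed.

End dyadic.

Section grid_counting.
Context (R : realType) (s : R) (M : nat).
Hypotheses (s0 : 0 < s) (M1 : (1 < M)%N).
Let h := 2 * s / M.-1%:R.

Let M10 : 0 < M.-1%:R :> R. Proof. by rewrite ltr0n -subn1 subn_gt0. Qed.
Let h0 : 0 < h. Proof. by rewrite divr_gt0// mulr_gt0. Qed.

Lemma gridE (k : 'I_M) : grid s k = - s + h * k%:R.
Proof. by rewrite /grid /h; congr (_ + _); rewrite mulrAC. Qed.

Lemma grid_norm (k : 'I_M) : `|grid s k| <= s.
Proof.
have hk0 : 0 <= h * k%:R by rewrite mulr_ge0// ltW.
have hk : h * k%:R <= 2 * s.
  rewrite /h mulrAC ler_pdivrMr//.
  by rewrite ler_pM2l ?mulr_gt0// ler_nat -ltnS prednK// ltnW.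
by rewrite gridE ler_norml; apply/andP; split; lra.
Qed.

Lemma grid_above y : `|y| <= s -> exists k : 'I_M, y <= grid s k <= y + h.
Proof.
rewrite ler_norml => /andP[sy ys].
have exn : exists n, y <= - s + h * n%:R.
  exists M.-1; rewrite /h divfK ?gt_eqF//; lra.
have [n yn nmin] := ex_minnP exn.
have nM : (n < M)%N.
  rewrite -[M]prednK ?ltnS; last exact: ltnW.
  by apply: nmin; rewrite /h divfK ?gt_eqF//; lra.
exists (Ordinal nM); rewrite gridE/= yn/=.
case: n yn nmin nM => [|n] yn nmin _; first (rewrite mulr0; have := h0; clearbody h; lra).
have : ~~ (y <= - s + h * n%:R) by apply/negP => /nmin; rewrite ltnn.
by rewrite -ltNge -natr1 mulrDr mulr1; lra.
Qed.

Lemma grid_rev (k : 'I_M) : grid s (rev_ord k) = - grid s k.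
Proof.
rewrite !gridE /= natrB// -[M in M%:R]prednK; last exact: ltnW.
rewrite -natr1 -[k.+1%:R]natr1 /h; field.
by rewrite gt_eqF.
Qed.

Lemma grid_below y : `|y| <= s -> exists k : 'I_M, y - h <= grid s k <= y.
Proof.
rewrite -normrN => /grid_above[k /andP[k1 k2]].
by exists (rev_ord k); rewrite grid_rev; apply/andP; split; lra.
Qed.

Lemma grid_le (k k' : 'I_M) : (grid s k <= grid s k') = (k <= k')%N.
Proof. by rewrite !gridE lerD2l ler_pM2l// ler_nat. Qed.

Lemma sum_nat_between (k1 k2 : 'I_M) : (k1 <= k2)%N ->
  (\sum_(k < M) (k1 <= k <= k2)%N = (k2 - k1).+1)%N.
Proof.
move=> k12; rewrite -subSn// -[RHS]muln1 -sum_nat_const_nat.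
rewrite (@big_nat_widen _ _ _ _ _ M)//= big_geq_mkord [RHS]big_mkcond/=.
by apply: eq_bigr => k _; rewrite ltnS andbC; case: (_ && _).
Qed.

(** Riemann sums of the indicator of an interval: if [k1] and [k2] are the
    extreme grid points of [A], convexity puts all grid points between them in
    [A], and the absence of further ones confines [A] to one more step [h] on
    each side.  The weight [2 * s / M] differs from the step [h], which costs
    [h] once more over the whole grid. *)
Lemma grid_count (A : set R) : is_interval A -> A `<=` [set y | `|y| <= s] ->
  `|2 * s / M%:R * \sum_(k < M) \1_A (grid s k) - fine (lebesgue_measure A)|
    <= 2 * h.
Proof.
move=> iA As.
have mA : measurable A by exact: is_interval_measurable.
have near1 (k1 : 'I_M) : A (grid s k1) -> (forall k : 'I_M, A (grid s k) -> (k1 <= k)%N) ->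
    forall y, A y -> grid s k1 - h <= y.
  move=> Ak1 kmin y Ay; rewrite leNgt; apply/negP => yk1.
  have [k /andP[yk ky]] := grid_above (As _ Ay).
  have kk1 : grid s k < grid s k1 by lra.
  have Ak : A (grid s k) by apply: (iA _ _ Ay Ak1); rewrite yk ltW.
  by have := kmin _ Ak; rewrite -grid_le leNgt kk1.
have near2 (k2 : 'I_M) : A (grid s k2) -> (forall k : 'I_M, A (grid s k) -> (k <= k2)%N) ->
    forall y, A y -> y <= grid s k2 + h.
  move=> Ak2 kmax y Ay; rewrite leNgt; apply/negP => yk2.
  have [k /andP[yk ky]] := grid_below (As _ Ay).
  have kk2 : grid s k2 < grid s k by lra.
  have Ak : A (grid s k) by apply: (iA _ _ Ak2 Ay); rewrite ky ltW.
  by have := kmax _ Ak; rewrite -grid_le leNgt kk2.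
have leA a b : a <= b -> (A `<=` `[a, b]) -> fine (lebesgue_measure A) <= b - a.
  move=> ab Aab; rewrite -lee_fin fineK.
    apply: (@le_trans _ _ (lebesgue_measure `[a, b]%classic)).
      by apply: le_measure => //; rewrite inE.
    rewrite lebesgue_measure_itv/= lte_fin; case: ltP => //.
    by rewrite lee_fin subr_ge0.
  rewrite ge0_fin_numE//.
  apply: (@le_lt_trans _ _ (lebesgue_measure `[a, b]%classic)).
    by apply: le_measure => //; rewrite inE.
  rewrite lebesgue_measure_itv/=; case: ifP => _; rewrite ?ltry//.
have finA : lebesgue_measure A \is a fin_num.
  rewrite ge0_fin_numE//.
  apply: (@le_lt_trans _ _ (lebesgue_measure `[- s, s]%classic)).
    apply: le_measure => //; rewrite ?inE//.
    by move=> y /As /=; rewrite in_itv/= ler_norml.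
  by rewrite lebesgue_measure_itv/=; case: ifP => _; rewrite ?ltry.
have geA a b : a <= b -> (`[a, b] `<=` A) -> b - a <= fine (lebesgue_measure A).
  move=> ab Aab; rewrite -lee_fin fineK//.
  apply: (@le_trans _ _ (lebesgue_measure `[a, b]%classic)).
    rewrite lebesgue_measure_itv/= lte_fin; case: ltP => //.
    by rewrite lee_fin subr_le0.
  by apply: le_measure => //; rewrite inE.
have LA0 : 0 <= fine (lebesgue_measure A) by rewrite fine_ge0.
have [[k0 Ak0]|noA] := pselect (exists k : 'I_M, A (grid s k)).
  pose p (k : 'I_M) := `[< A (grid s k) >].
  have pk0 : p k0 by apply/asboolP.
  pose k1 := [arg min_(k < k0 | p k) (k : nat)].
  pose k2 := [arg max_(k > k0 | p k) (k : nat)].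
  have [pk1 k1min] : p k1 /\ forall k : 'I_M, A (grid s k) -> (k1 <= k)%N.
    by rewrite /k1; case: arg_minnP => // k pk kmin; split => // k' /asboolP/kmin.
  have [pk2 k2max] : p k2 /\ forall k : 'I_M, A (grid s k) -> (k <= k2)%N.
    by rewrite /k2; case: arg_maxnP => // k pk kmin; split => // k' /asboolP/kmin.
  move/asboolP in pk1; move/asboolP in pk2.
  have k12 : (k1 <= k2)%N by exact: k1min.
  have -> : \sum_(k < M) \1_A (grid s k) = (k2 - k1).+1%:R :> R.
    rewrite -sum_nat_between// natr_sum; apply: eq_bigr => k _.
    rewrite indicE; congr ((nat_of_bool _)%:R).
    apply/idP/idP => [/set_mem Ak|/andP[kk1 kk2]].
      by rewrite k1min// k2max.
    by apply/mem_set/(iA _ _ pk1 pk2); rewrite !grid_le kk1.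
  have kh : grid s k2 - grid s k1 = h * (k2 - k1)%:R.
    by rewrite !gridE natrB//; ring.
  have lo : h * (k2 - k1)%:R <= fine (lebesgue_measure A).
    rewrite -kh; apply: geA; first by rewrite grid_le.
    by move=> y /=; rewrite in_itv/=; exact: iA.
  have hi : fine (lebesgue_measure A) <= h * (k2 - k1)%:R + 2 * h.
    have -> : h * (k2 - k1)%:R + 2 * h = (grid s k2 + h) - (grid s k1 - h).
      by rewrite -kh; ring.
    apply: leA => [|y Ay].
      have g12 : grid s k1 <= grid s k2 by rewrite grid_le.
      by have := h0; clearbody h; lra.
    by rewrite /= in_itv/= near1// near2.
  have M0 : 0 < M%:R :> R by rewrite ltr0n ltnW.
  have -> : 2 * s / M%:R = h - h / M%:R.
    have ME : M%:R = M.-1%:R + 1 :> R by rewrite natr1 prednK// ltnW.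
    rewrite /h ME; move: (M.-1%:R) M10 => m m0.
    by field; rewrite !gt_eqF// ltr_wpDr.
  have mM : ((k2 - k1).+1 <= M)%N.
    by rewrite (leq_ltn_trans (leq_subr _ _)).
  have e1 : 0 <= h / M%:R * (k2 - k1).+1%:R <= h.
    apply/andP; split; first by rewrite mulr_ge0// divr_ge0// ltW.
    by rewrite mulrAC ler_pdivrMr// ler_pM2l// ler_nat.
  rewrite mulrBl; move: e1; rewrite -natr1; move: lo hi.
  move: (k2 - k1)%:R (fine _) => m L lo hi /andP[e1 e2].
  by rewrite ler_norml; apply/andP; split; lra.
have -> : \sum_(k < M) \1_A (grid s k) = 0 :> R.
  apply: big1 => k _; rewrite indicE memNset// => Ak.
  by apply: noA; exists k.
rewrite mulr0 sub0r normrN ger0_norm//.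
have [[a Aa]|A0] := pselect (exists a, A a).
  have -> : 2 * h = (a + h) - (a - h) by ring.
  apply: leA => [|y Ay]; first by have := h0; clearbody h; lra.
  rewrite /= in_itv/=; apply/andP; split; rewrite leNgt; apply/negP => ya.
    have [k /andP[yk ky]] := grid_above (As _ Ay).
    by apply: noA; exists k; apply: (iA _ _ Ay Aa); rewrite yk/=; lra.
  have [k /andP[yk ky]] := grid_above (As _ Aa).
  by apply: noA; exists k; apply: (iA _ _ Aa Ay); rewrite yk/=; lra.
suff -> : A = set0 by rewrite measure0/= mulr_ge0// ltW.
by apply/seteqP; split => // a Aa; apply: A0; exists a.
Qed.

End grid_counting.

(** * Second moment of a sample mean *)

Section sample_mean.
Context (R : realType) (disp : measure_display) (Omega : measurableType disp).
Variable P : probability Omega R.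

Lemma measurable_sample_mean N (H : 'I_N -> Omega -> R) :
  (forall i, measurable_fun setT (H i)) ->
  measurable_fun setT (fun w => N%:R^-1 * \sum_(i < N) H i w).
Proof.
move=> mH; apply: measurable_funM; first exact: measurable_cst.
exact: measurable_sum.
Qed.

(** The variance of a mean of pairwise uncorrelated variables with values in
    [0, b].  The square is expanded as [(D - v)^2 + 2 v D = D^2 + v^2], where
    every term is nonnegative, so that only Tonelli is called on. *)
Lemma sample_mean_second_moment N (H : 'I_N -> Omega -> R) (b v : R) :
  (0 < N)%N -> (forall i, measurable_fun setT (H i)) ->
  (forall i w, 0 <= H i w <= b) ->
  (forall i, \int[P]_w (H i w)%:E = v%:E)%E ->
  (forall i j, i != j -> \int[P]_w (H i w * H j w)%:E = (v ^+ 2)%:E)%E ->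
  (\int[P]_w ((N%:R^-1 * (\sum_(i < N) H i w) - v) ^+ 2)%:E
    <= (b ^+ 2 / N%:R)%:E)%E.
Proof.
move=> N0 mH Hb EH EHH.
have N0R : 0 < N%:R :> R by rewrite ltr0n.
pose S w := \sum_(i < N) H i w.
pose D w := N%:R^-1 * S w.
have mS : measurable_fun setT S by exact: measurable_sum.
have mD : measurable_fun setT D by exact: measurable_sample_mean.
have S0 w : 0 <= S w by apply: sumr_ge0 => i _; have /andP[] := Hb i w.
have D0 w : 0 <= D w by rewrite mulr_ge0// invr_ge0 ltW.
have v0 : 0 <= v.
  rewrite -lee_fin -(EH (Ordinal N0)); apply: integral_ge0 => w _.
  by rewrite lee_fin; have /andP[] := Hb (Ordinal N0) w.
have HH0 i j w : 0 <= H i w * H j w.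
  by have /andP[? _] := Hb i w; have /andP[? _] := Hb j w; rewrite mulr_ge0.
have ED : (\int[P]_w (D w)%:E = v%:E)%E.
  rewrite (eq_integral (fun w => (N%:R^-1)%:E * \sum_(i < N) (H i w)%:E)%E); last first.
    by move=> w _; rewrite sumEFin -EFinM.
  rewrite ge0_integralZl//=; last 2 first.
  - by apply: emeasurable_sum => i; exact/measurable_EFinP.
  - by move=> w _; rewrite sumEFin lee_fin S0.
  rewrite ge0_integral_sum//; last 2 first.
  - by move=> i; exact/measurable_EFinP.
  - by move=> i w _; rewrite lee_fin; have /andP[] := Hb i w.
  rewrite (eq_bigr (fun=> v%:E))// sumEFin -EFinM sumr_const card_ord.
  by rewrite -[v *+ N]mulr_natl mulKf// gt_eqF.
have ESS : (\int[P]_w (S w ^+ 2)%:E <= (N%:R * b ^+ 2 + N%:R ^+ 2 * v ^+ 2)%:E)%E.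
  rewrite (eq_integral (fun w => \sum_(i < N) \sum_(j < N) (H i w * H j w)%:E)%E); last first.
    move=> w _; rewrite expr2 /S big_distrlr/= -sumEFin; apply: eq_bigr => i _.
    by rewrite -sumEFin.
  rewrite ge0_integral_sum//; last 2 first.
  - move=> i; apply: emeasurable_sum => j; apply/measurable_EFinP.
    exact: measurable_funM.
  - by move=> i w _; apply: sume_ge0 => j _; rewrite lee_fin.
  have bnd i : (\int[P]_w \sum_(j < N) (H i w * H j w)%:E <=
      (b ^+ 2 + N%:R * v ^+ 2)%:E)%E.
    rewrite ge0_integral_sum//; last 2 first.
    - by move=> j; apply/measurable_EFinP; exact: measurable_funM.
    - by move=> j w _; rewrite lee_fin.
    rewrite (bigD1 i)//= EFinD; apply: leeD.
      apply: (@le_trans _ _ (\int[P]_w (b ^+ 2)%:E)%E).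
        apply: ge0_le_integral => //.
        - by move=> w _; rewrite lee_fin.
        - by apply/measurable_EFinP; exact: measurable_funM.
        - move=> w _; rewrite lee_fin expr2.
          by have /andP[? ?] := Hb i w; rewrite ler_pM.
      by rewrite integral_cst//= probability_setT mule1.
    rewrite (eq_bigr (fun=> (v ^+ 2)%:E)); last by move=> j ji; rewrite EHH// eq_sym.
    rewrite sumEFin lee_fin sumr_const -[leLHS]mulr_natl ler_wpM2r ?exprn_ge0//.
    by rewrite ler_nat (leq_trans (max_card _))// card_ord.
  apply: (le_trans (lee_sum _ (fun i _ => bnd i))).
  rewrite sumEFin lee_fin sumr_const card_ord -[leLHS]mulr_natl.
  by rewrite le_eqVlt; apply/orP; left; apply/eqP; ring.
have sq0 w : 0 <= (D w - v) ^+ 2 by exact: sqr_ge0.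
have msq : measurable_fun setT (fun w => (D w - v) ^+ 2).
  by apply: measurable_funX; apply: measurable_funB => //; exact: measurable_cst.
rewrite -[leLHS]/(\int[P]_w ((D w - v) ^+ 2)%:E)%E.
have key : (\int[P]_w ((D w - v) ^+ 2)%:E + (2 * v)%:E * \int[P]_w (D w)%:E =
    \int[P]_w ((N%:R ^- 2)%:E * (S w ^+ 2)%:E + (v ^+ 2)%:E))%E.
  rewrite -ge0_integralZl//=; last 3 first.
  - exact/measurable_EFinP.
  - by move=> w _; rewrite lee_fin.
  - by rewrite lee_fin mulr_ge0.
  rewrite -ge0_integralD//=; last 4 first.
  - by move=> w _; rewrite lee_fin.
  - exact/measurable_EFinP.
  - by move=> w _; rewrite -EFinM lee_fin !mulr_ge0.
  - by apply: emeasurable_funM => //; exact/measurable_EFinP.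
  apply: eq_integral => w _; rewrite -!EFinM -!EFinD; congr (_%:E).
  by rewrite /D; field; rewrite gt_eqF.
have NV : 0 <= N%:R ^- 2 :> R by rewrite invr_ge0 exprn_ge0// ltW.
have mS2 : measurable_fun setT (fun w => (S w ^+ 2)%:E).
  by apply/measurable_EFinP; exact: measurable_funX.
rewrite ge0_integralD//= in key; last 3 first.
- by move=> w _; rewrite -EFinM lee_fin mulr_ge0// sqr_ge0.
- exact: emeasurable_funM.
- by move=> w _; rewrite lee_fin sqr_ge0.
rewrite ge0_integralZl//= in key; last first.
- by move=> w _; rewrite lee_fin sqr_ge0.
rewrite ED integral_cst//= probability_setT mule1 -EFinM in key.
rewrite -(@leeD2rE _ (2 * v * v)%:E)// key.
apply: (@le_trans _ _ ((N%:R ^- 2)%:E * (N%:R * b ^+ 2 + N%:R ^+ 2 * v ^+ 2)%:E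
   + (v ^+ 2)%:E)%E).
  by apply: leeD => //; apply: lee_wpmul2l; rewrite ?lee_fin.
rewrite -EFinM -!EFinD lee_fin le_eqVlt; apply/orP; left; apply/eqP.
by field; rewrite gt_eqF.
Qed.

End sample_mean.

(** * Thresholds of prescribed mean length *)

Lemma measurable_lt_set (R : realType) d (T : measurableType d)
    (f g : T -> R) : measurable_fun setT f -> measurable_fun setT g ->
  measurable [set x | f x < g x].
Proof.
move=> mf mg; have := measurable_fun_ltr mf mg measurableT (Y := [set true]) I.
by rewrite setTI.
Qed.

Section superlevel_length.
Context (R : realType) (s : R).
Implicit Types (g : R -> R) (r t : R).

Definition superlevel_length g t : \bar R :=
  lebesgue_measure [set y | t < g y].

Lemma measurable_superlevel g t :
  measurable_fun setT g -> measurable [set y | t < g y].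
Proof.
move=> mg; rewrite -[X in measurable X]setTI.
by have := mg measurableT `]t, +oo[%classic (measurable_itv _); rewrite set_itvoy.
Qed.

Lemma superlevel_length_noninc g r t : measurable_fun setT g -> r <= t ->
  (superlevel_length g t <= superlevel_length g r)%E.
Proof.
move=> mg rt; apply: le_measure; rewrite ?inE; try exact: measurable_superlevel.
by move=> y /=; exact: le_lt_trans.
Qed.

Lemma lebesgue_measure_norm_le : 0 < s -> lebesgue_measure [set y : R | `|y| <= s] = (2 * s)%:E.
Proof.
move=> s0; have -> : [set y : R | `|y| <= s] = `[- s, s]%classic.
  by apply/seteqP; split => y /=; rewrite in_itv/= ler_norml.
rewrite lebesgue_measure_itv/= lte_fin.
have -> : - s < s by lra.
by rewrite -EFinB; congr (_%:E); ring.
Qed.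

Lemma measurable_norm_le : measurable [set y : R | `|y| <= s].
Proof.
have -> : [set y : R | `|y| <= s] = `[- s, s]%classic.
  by apply/seteqP; split => y /=; rewrite in_itv/= ler_norml.
exact: measurable_itv.
Qed.

Lemma superlevel_length_le g t : 0 < s -> (forall y, s < `|y| -> g y = 0) ->
  measurable_fun setT g -> 0 <= t -> (superlevel_length g t <= (2 * s)%:E)%E.
Proof.
move=> s0 g0 mg t0; rewrite -lebesgue_measure_norm_le//.
apply: le_measure; rewrite ?inE.
- exact: measurable_superlevel.
- exact: measurable_norm_le.
- move=> y /= tg; rewrite leNgt; apply/negP => /g0 gy.
  by move: tg; rewrite gy ltNge t0.
Qed.

End superlevel_length.

Section level_selection.
Context (R : realType) (disp d1 d2 : measure_display).
Context (Omega : measurableType disp) (T1 : measurableType d1).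
Context (T2 : measurableType d2) (P : probability Omega R).
Variables (s K : R) (q : T1 -> T2 -> R -> R) (Z : Omega -> T2).
Hypothesis s0 : 0 < s.
Hypothesis K0 : 0 <= K.
Hypothesis mq : measurable_fun setT (fun a : T1 * T2 * R => q a.1.1 a.1.2 a.2).
Hypothesis q0 : forall S z y, s < `|y| -> q S z y = 0.
Hypothesis mZ : measurable_fun setT Z.

Let mq2 S z : measurable_fun setT (q S z).
Proof.
exact: (@measurable_fun_section1 _ _ _ _ _ _ (fun a : T1 * T2 => q a.1 a.2) mq (S, z)).
Qed.

(** The length is the measure of a section of a measurable set, even when the
    threshold depends on the parameter [S]. *)
Lemma measurable_superlevel_length (tau : T1 -> R) :
  measurable_fun setT tau ->
  measurable_fun setT
    (fun a : T1 * T2 => superlevel_length (q a.1 a.2) (tau a.1)).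
Proof.
move=> mtau.
pose A := [set a : T1 * T2 * R | tau a.1.1 < q a.1.1 a.1.2 a.2].
have mA : measurable A.
  have mt : measurable_fun setT (fun a : T1 * T2 * R => tau a.1.1).
    by apply: measurableT_comp => //; apply: measurableT_comp.
  exact: measurable_lt_set mt mq.
have := @measurable_fun_xsection _ _ (T1 * T2)%type (measurableTypeR R) R
  (@lebesgue_measure R) A mA.
apply: eq_measurable_fun => a _ /=; rewrite /superlevel_length.
congr (lebesgue_measure _).
by apply/seteqP; split => y; rewrite /xsection/= ?inE.
Qed.

(** The expected length, over a fresh [Z], of the region where the density
    exceeds [t]; [S] stands for the labeled sample. *)
Definition mean_length (S : T1) (t : R) : \bar R :=
  (\int[P]_w superlevel_length (q S (Z w)) t)%E.

Lemma measurable_mean_length t : measurable_fun setT (mean_length ^~ t).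
Proof.
have mpair : measurable_fun setT (fun a : T1 * Omega => (a.1, Z a.2)).
  by apply: measurable_fun_pair => //; exact: measurableT_comp.
have mt : measurable_fun setT (cst t : T1 -> R) by exact: measurable_cst.
have := measurableT_comp (measurable_superlevel_length mt) mpair.
move=> /(@measurable_fun_fubini_tonelli_F _ _ _ _ R P).
by apply => a; exact: measure_ge0.
Qed.

Lemma measurable_superlevel_length_Z S t :
  measurable_fun setT (fun w => superlevel_length (q S (Z w)) t).
Proof.
have mt : measurable_fun setT (cst t : T1 -> R) by exact: measurable_cst.
have := measurable_fun_section1 (phi := fun S z => superlevel_length (q S z) t)
  (measurable_superlevel_length mt) S.
by move=> m; exact: measurableT_comp m mZ.
Qed.

Lemma mean_length_noninc S r t : r <= t ->
  (mean_length S t <= mean_length S r)%E.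
Proof.
move=> rt; apply: ge0_le_integral => //.
- exact: measurable_superlevel_length_Z.
- exact: measurable_superlevel_length_Z.
- by move=> w _; exact: superlevel_length_noninc.
Qed.

Lemma mean_length_le S t : 0 <= t -> (mean_length S t <= (2 * s)%:E)%E.
Proof.
move=> t0; apply: (@le_trans _ _ (\int[P]_w (2 * s)%:E)%E).
  apply: ge0_le_integral => //.
  - exact: measurable_superlevel_length_Z.
  - by move=> w _; apply: superlevel_length_le => // y; exact: q0.
by rewrite integral_cst//= probability_setT mule1.
Qed.

Lemma mean_length_ge0 S t : (0 <= mean_length S t)%E.
Proof. by apply: integral_ge0 => w _; exact: measure_ge0. Qed.

Lemma mean_length_fin S t : 0 <= t -> mean_length S t \is a fin_num.
Proof.
move=> t0; rewrite ge0_fin_numE ?mean_length_ge0//.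
by rewrite (le_lt_trans (mean_length_le _ t0))// ltry.
Qed.

Hypothesis mean_lip : forall S r t, 0 <= r -> r <= t ->
  (mean_length S r <= mean_length S t + (K * (t - r))%:E)%E.
Hypothesis mean_top : forall S, mean_length S 0 = (2 * s)%:E.
Hypothesis mean_bot : forall S, exists2 t, 0 <= t & mean_length S t = 0%E.

(** The threshold at which the mean length equals [v].  It depends on the
    labeled sample [S] but not on the unlabeled one: given [S] it is a constant,
    and this is what makes a plain variance bound sufficient. *)
Definition level (v : R) (S : T1) : R :=
  generalized_inverse (fun t => fine (mean_length S t)) v.

Lemma level_spec v S : 0 < v -> v < 2 * s ->
  [/\ 0 <= level v S, mean_length S (level v S) = v%:E &
      forall c, 0 <= c -> (c < level v S) = (v%:E < mean_length S c)%E].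
Proof.
move=> v0 v2s.
have fr t : 0 <= t -> (fine (mean_length S t))%:E = mean_length S t.
  by move=> t0; rewrite fineK// mean_length_fin.
have [] := @generalized_inverse_lipschitz R (fun t => fine (mean_length S t)) K v.
- exact: K0.
- move=> r t r0 rt; rewrite -lee_fin !fr//; first exact: mean_length_noninc.
  exact: le_trans rt.
- move=> r t r0 rt; rewrite -lee_fin EFinD !fr//; first exact: mean_lip.
  exact: le_trans rt.
- by rewrite mean_top/= ltW.
- by have [t t0 mt] := mean_bot S; exists t => //; rewrite mt/= ltW.
move=> l0 ml lc; split => //.
  by rewrite -[LHS]fr// ml.
by move=> c c0; rewrite lc// -lte_fin fr.
Qed.

Lemma measurable_level v : 0 < v -> v < 2 * s -> measurable_fun setT (level v).
Proof.
move=> v0 v2s.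
apply: (measurability _ (RGenOInfty.measurableE R)) => //.
move=> _ [_ [c ->] <-]; rewrite setTI set_itvoy.
have [c0|c0] := ltP c 0.
  rewrite (_ : level v @^-1` _ = setT)//; apply/seteqP; split => S //= _.
  by have [l0 _ _] := level_spec S v0 v2s; exact: lt_le_trans l0.
have -> : level v @^-1` [set x | c < x] = [set S | (v%:E < mean_length S c)%E].
  apply/seteqP; split => S /=.
    by have [_ _ ->] := level_spec S v0 v2s.
  by have [_ _ ->] := level_spec S v0 v2s.
rewrite -[X in measurable X]setTI.
by apply: emeasurable_fun_o_infty => //; exact: measurable_mean_length.
Qed.

Context (N : nat) (W : Omega -> T1) (Zs : 'I_N -> Omega -> T2).
Hypothesis N0 : (0 < N)%N.
Hypothesis mW : measurable_fun setT W.
Hypothesis mZs : forall i, measurable_fun setT (Zs i).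
Hypothesis lawZ : forall i, same_law P (Zs i) Z.
Hypothesis indWZ : forall i, independent2 P W (Zs i).
Hypothesis indWZZ : forall i j, i != j ->
  independent2 P (fun w => (W w, Zs i w)) (Zs j).

Definition sample_length (v : R) (i : 'I_N) (w : Omega) : R :=
  fine (superlevel_length (q (W w) (Zs i w)) (level v (W w))).

Variable v : R.
Hypothesis v0 : 0 < v.
Hypothesis v2s : v < 2 * s.

Let len (S : T1) (z : T2) : \bar R := superlevel_length (q S z) (level v S).

Let len_le S z : (len S z <= (2 * s)%:E)%E.
Proof.
have [l0 _ _] := level_spec S v0 v2s.
by apply: superlevel_length_le => // y; exact: q0.
Qed.

Let len_ge0 S z : (0 <= len S z)%E. Proof. exact: measure_ge0. Qed.

Let len_fin S z : len S z \is a fin_num.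
Proof. by rewrite ge0_fin_numE// (le_lt_trans (len_le _ _))// ltry. Qed.

Let mlen : measurable_fun setT (fun a : T1 * T2 => len a.1 a.2).
Proof.
have ml := measurable_level v0 v2s.
exact: measurable_superlevel_length ml.
Qed.

Lemma sample_lengthE i w : (sample_length v i w)%:E = len (W w) (Zs i w).
Proof. exact: fineK (len_fin _ _). Qed.

Lemma measurable_sample_length i : measurable_fun setT (sample_length v i).
Proof.
have mpair : measurable_fun setT (fun w => (W w, Zs i w)).
  exact: measurable_fun_pair.
have m1 := measurableT_comp mlen mpair.
exact: measurableT_comp (@fine_measurable R setT measurableT) m1.
Qed.

Lemma sample_length_bound i w : 0 <= sample_length v i w <= 2 * s.
Proof. by rewrite -!lee_fin sample_lengthE len_ge0 len_le. Qed.

Let mean_len S i : (\int[P]_w len S (Zs i w) = v%:E)%E.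
Proof.
have [_ <- _] := level_spec S v0 v2s.
apply: (integral_same_law (phi := len S)) => //.
exact: measurable_fun_section1.
Qed.

Lemma expectation_sample_length i :
  (\int[P]_w (sample_length v i w)%:E = v%:E)%E.
Proof.
under eq_integral do rewrite sample_lengthE.
rewrite (integral_independent2 mW (mZs i) (indWZ i) mlen len_ge0).
under eq_integral do rewrite mean_len.
by rewrite integral_cst//= probability_setT mule1.
Qed.

(** Decoupling the last observation from the rest replaces its length by the
    conditional mean, which is the constant [v] at the level [level v S]. *)
Lemma expectation_sample_lengthM i j : i != j ->
  (\int[P]_w (sample_length v i w * sample_length v j w)%:E = (v ^+ 2)%:E)%E.
Proof.
move=> ij.
under eq_integral do rewrite EFinM !sample_lengthE.
pose phi (a : T1 * T2) (z : T2) := (len a.1 a.2 * len a.1 z)%E.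
have mWZ : measurable_fun setT (fun w => (W w, Zs i w)).
  exact: measurable_fun_pair.
have mphi : measurable_fun setT (fun b : T1 * T2 * T2 => phi b.1 b.2).
  apply: emeasurable_funM.
    exact: (measurableT_comp mlen).
  have mpair : measurable_fun setT (fun b : T1 * T2 * T2 => (b.1.1, b.2)).
    by apply: measurable_fun_pair => //; exact: measurableT_comp.
  exact: measurableT_comp mlen mpair.
have phi0 a z : (0 <= phi a z)%E by rewrite mule_ge0.
rewrite -[LHS]/(\int[P]_w phi (W w, Zs i w) (Zs j w))%E.
rewrite (integral_independent2 mWZ (mZs j) (indWZZ ij) mphi phi0).
transitivity (\int[P]_w (v%:E * (sample_length v i w)%:E))%E.
  apply: eq_integral => w _; rewrite /phi/= sample_lengthE.
  rewrite ge0_integralZl//=; first by rewrite mean_len muleC.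
  have := measurableT_comp (measurable_fun_section1 mlen (W w)) (mZs j).
  by apply.
rewrite ge0_integralZl//=.
- by rewrite expectation_sample_length -EFinM.
- exact/measurable_EFinP/measurable_sample_length.
- by move=> w _; rewrite sample_lengthE.
- by rewrite lee_fin ltW.
Qed.

Lemma level_second_moment :
  (\int[P]_w ((N%:R^-1 * (\sum_(i < N) sample_length v i w) - v) ^+ 2)%:E
    <= ((2 * s) ^+ 2 / N%:R)%:E)%E.
Proof.
apply: sample_mean_second_moment => //.
- exact: measurable_sample_length.
- exact: sample_length_bound.
- exact: expectation_sample_length.
- exact: expectation_sample_lengthM.
Qed.

End level_selection.

(** * Continuity of the mean length through randomization *)

Lemma measurable_bool_natr (R : realType) d (T : measurableType d)
    (b : T -> bool) : measurable_fun setT b ->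
  measurable_fun setT (fun x => (b x)%:R : R).
Proof.
move=> mb; apply: (eq_measurable_fun (fun x => if b x then 1 else 0 : R)).
  by move=> x _; case: (b x).
by apply: measurable_fun_ifT => //; exact: measurable_cst.
Qed.

Section randomization.
Context (R : realType) (disp d : measure_display).
Context (Omega : measurableType disp) (T : measurableType d).
Variables (P : probability Omega R) (s k : R).
Variables (f : T -> R -> R) (X : Omega -> T) (zeta : Omega -> R).
Hypothesis s0 : 0 < s.
Hypothesis k0 : 0 <= k.
Hypothesis mf : measurable_fun setT (fun a : T * R => f a.1 a.2).
Hypothesis f0 : forall x y, s < `|y| -> f x y = 0.
Hypothesis mX : measurable_fun setT X.
Hypothesis mzeta : measurable_fun setT zeta.
Hypothesis indXz : independent2 P X zeta.
Hypothesis zeta_itv : forall a b, a <= b ->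
  (P (zeta @^-1` `]a, b]) <= (k * (b - a))%:E)%E.

Let g (x : T) (z y : R) : R := f x y + z * (`|y| <= s)%R%:R.

Let mg : measurable_fun setT (fun a : T * R * R => g a.1.1 a.1.2 a.2).
Proof.
apply: measurable_funD.
  have mpair : measurable_fun setT (fun a : T * R * R => (a.1.1, a.2)).
    by apply: measurable_fun_pair => //; exact: measurableT_comp.
  exact: measurableT_comp mf mpair.
apply: measurable_funM; first exact: measurableT_comp.
apply: measurable_bool_natr; apply: measurable_fun_ler => //.
  by apply: measurableT_comp => //; exact: measurableT_comp.
Qed.

Let mg1 x z : measurable_fun setT (g x z).
Proof.
exact: (@measurable_fun_section1 _ _ _ _ _ _ (fun a : T * R => g a.1 a.2) mg (x, z)).
Qed.

Let band (r t : R) (x : T) (z : R) : set R := [set y | r < g x z y <= t].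

Let measurable_band r t : measurable [set a : T * R * R | band r t a.1.1 a.1.2 a.2].
Proof.
have mc c : measurable_fun setT (cst c : T * R * R -> R) by exact: measurable_cst.
have m1 := measurable_lt_set (mc r) mg.
have m2 := measurable_lt_set (mc t) mg.
have := measurableI _ _ m1 (measurableC m2).
congr (measurable _); apply/seteqP; split => a /=.
  by move=> [rg /negP]; rewrite -leNgt /band/= rg.
by move=> /andP[rg h]; split => //; apply/negP; rewrite -leNgt.
Qed.

Let measurable_band1 r t x z : measurable (band r t x z).
Proof.
have := measurable_xsection (x, z) (measurable_band r t).
by congr (measurable _); apply/seteqP; split => y; rewrite /xsection/= ?inE.
Qed.

Let phi r t (x : T) (z : R) : \bar R := lebesgue_measure (band r t x z).

Let mphi r t : measurable_fun setT (fun a : T * R => phi r t a.1 a.2).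
Proof.
have := @measurable_fun_xsection _ _ (T * R)%type (measurableTypeR R) R
  (@lebesgue_measure R) _ (measurable_band r t).
apply: eq_measurable_fun => a _ /=; rewrite /phi.
congr (lebesgue_measure _).
by apply/seteqP; split => y; rewrite /xsection/= ?inE.
Qed.

(* Tonelli: the mean length of the band is the integral over [y] of the
   probability that [y] belongs to it. *)
Let mean_band r t x : 0 <= r -> r <= t ->
  (\int[P]_w phi r t x (zeta w) <= (2 * s * k * (t - r))%:E)%E.
Proof.
move=> r0 rt.
pose A := [set a : Omega * R | band r t x (zeta a.1) a.2].
have mA : measurable (A : set (Omega * measurableTypeR R)).
  have mh : measurable_fun setT
      (fun a : Omega * R => ((x, zeta a.1), a.2) : T * R * R).
    apply: measurable_fun_pair => //; apply: measurable_fun_pair.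
      exact: measurable_cst.
    exact: measurableT_comp.
  rewrite -[X in measurable X]setTI.
  exact: (mh measurableT _ (measurable_band r t)).
have := @indic_fubini_tonelli _ _ Omega (measurableTypeR R) R P
  (@lebesgue_measure R) A mA.
rewrite indic_fubini_tonelli_FE// indic_fubini_tonelli_GE// => E.
have -> : (\int[P]_w phi r t x (zeta w) =
    \int[P]_w (@lebesgue_measure R \o xsection A) w)%E.
  apply: eq_integral => w _ /=; rewrite /phi; congr (lebesgue_measure _).
  by apply/seteqP; split => y; rewrite /xsection/= ?inE.
rewrite E.
pose B := [set y : R | `|y| <= s].
have mB : measurable B by exact: measurable_norm_le.
apply: (@le_trans _ _ (\int[@lebesgue_measure R]_y
    ((k * (t - r))%:E * (\1_B y)%:E))%E); last first.
  rewrite ge0_integralZl//; last 2 first.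
  - by apply/measurable_EFinP; exact: measurable_indic.
  - by rewrite lee_fin mulr_ge0// subr_ge0.
  rewrite [X in (_ * X)%E](_ : _ = (2 * s)%:E); last first.
    by rewrite integral_indic// setIT; exact: lebesgue_measure_norm_le.
  rewrite -EFinM lee_fin.
  by rewrite le_eqVlt; apply/orP; left; apply/eqP; ring.
apply: ge0_le_integral_nonmeasurable; first by move=> y; exact: measure_ge0.
move=> y /=; rewrite indicE.
have [By|nBy] := boolP (y \in B).
  rewrite mule1; have := zeta_itv (lerB rt (lexx (f x y))).
  have -> : t - f x y - (r - f x y) = t - r by ring.
  apply: le_trans; rewrite le_eqVlt; apply/orP; left; apply/eqP.
  congr (P _); apply/seteqP; split => w; rewrite /ysection/= inE /A/band/g/=;
    move/set_mem: By => /= ->; rewrite mulr1 in_itv/= ltrBlDl lerBrDl//.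
rewrite mule0 (_ : ysection _ _ = set0) ?measure0//.
apply/seteqP; split => // w; rewrite /ysection/= inE /A/band/g/=.
have sy : s < `|y| by rewrite ltNge; apply: contra nBy => ?; exact/mem_set.
by rewrite f0// leNgt sy mulr0 addr0 ltNge r0.
Qed.

(** For a fixed point [y], the noisy density lies in the band ]r, t] exactly
    when the noise lies in an interval of length [t - r], which has probability
    at most [k * (t - r)] whatever [X] is.  Integrating over the points [y] with
    [`|y| <= s] gives the constant [2 * s * k]. *)
Lemma mean_superlevel_length_lipschitz r t : 0 <= r -> r <= t ->
  (\int[P]_w superlevel_length (g (X w) (zeta w)) r <=
   \int[P]_w superlevel_length (g (X w) (zeta w)) t
   + (2 * s * k * (t - r))%:E)%E.
Proof.
move=> r0 rt.
have mcomp (h : T -> R -> \bar R) :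
    measurable_fun setT (fun a : T * R => h a.1 a.2) ->
    measurable_fun setT (fun w => h (X w) (zeta w)).
  move=> mh; have mpair : measurable_fun setT (fun w => (X w, zeta w)).
    exact: measurable_fun_pair.
  exact: measurableT_comp mh mpair.
have ml c : measurable_fun setT
    (fun a : T * R => superlevel_length (g a.1 a.2) c).
  have mc : measurable_fun setT (cst c : T -> R) by exact: measurable_cst.
  exact: (measurable_superlevel_length (q := g) mg mc).
apply: (@le_trans _ _ (\int[P]_w (superlevel_length (g (X w) (zeta w)) t
    + phi r t (X w) (zeta w)))%E).
  apply: ge0_le_integral => //.
  - exact: (mcomp (fun x z => superlevel_length (g x z) r)).
  - apply: emeasurable_funD; last exact: mcomp.
    exact: (mcomp (fun x z => superlevel_length (g x z) t)).
  - move=> w _; rewrite /superlevel_length /phi.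
    apply: (le_trans _ (measureU2 _ _ _)).
    + apply: le_measure; rewrite ?inE.
      * exact: measurable_superlevel.
      * by apply: measurableU; [exact: measurable_superlevel|exact: measurable_band1].
      * move=> y /= ry; have [yt|ty] := leP (g (X w) (zeta w) y) t.
          by right; rewrite /band/= ry yt.
        by left.
    + exact: measurable_superlevel.
    + exact: measurable_band1.
rewrite ge0_integralD//; last 2 first.
- exact: (mcomp (fun x z => superlevel_length (g x z) t)).
- exact: mcomp.
apply: leeD => //.
rewrite (integral_independent2 mX mzeta indXz (mphi r t)); last first.
  by move=> x z; exact: measure_ge0.
apply: (@le_trans _ _ (\int[P]_w (2 * s * k * (t - r))%:E)%E).
  apply: ge0_le_integral_nonmeasurable => w.
    by apply: integral_ge0 => w' _; exact: measure_ge0.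
  exact: mean_band.
by rewrite integral_cst//= probability_setT mule1.
Qed.

End randomization.

Lemma uniform_prob_itv_le (R : realType) (u : R) (hu : 0 < u) (a b : R) :
  a <= b -> (uniform_prob hu `]a, b] <= (u^-1 * (b - a))%:E)%E.
Proof.
move=> ab; rewrite /uniform_prob.
apply: (@le_trans _ _ (\int[lebesgue_measure]_(x in `]a, b]) (u^-1)%:E)%E).
  apply: ge0_le_integral => //.
  - by move=> x _; rewrite lee_fin uniform_pdf_ge0.
  - by apply/measurable_EFinP/measurable_funTS; exact: measurable_uniform_pdf.
  - move=> x _; rewrite lee_fin /uniform_pdf subr0; case: ifP => // _.
    by rewrite invr_ge0 ltW.
rewrite integral_cst//= lebesgue_measure_itv/= lte_fin.
case: ifP => _; first by rewrite -EFinB -EFinM.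
by rewrite mule0 lee_fin mulr_ge0 ?subr_ge0// invr_ge0 ltW.
Qed.

(** * The Gaussian density estimate *)

(** On nonnegative numbers, zero included, the inverse is the power [-1]. *)
Lemma measurable_inv_ge0 (R : realType) d (T : measurableType d) (f : T -> R) :
  (forall x, 0 <= f x) -> measurable_fun setT f ->
  measurable_fun setT (fun x => (f x)^-1).
Proof.
move=> f0 mf; apply: (eq_measurable_fun (fun x => f x `^ (-1))).
  by move=> x _; rewrite powR_inv1.
exact: measurableT_comp (measurable_powR _) mf.
Qed.

Section p_hat_facts.
Context (R : realType) (d : nat) (s : R).
Hypothesis s0 : 0 < s.

Section fixed.
Variables (f sigma2 : d.-tuple R -> R).
Hypothesis sigma20 : forall x, 0 <= sigma2 x.

(** For [1 <= s] the value lies between [s^-1] and [s]; for [s < 1] it is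
    [s^-1], [s] or their sum. *)
Lemma sigma2_hat_ge x : Num.min s^-1 s <= sigma2_hat s sigma2 x.
Proof.
have V0 : 0 < s^-1 by rewrite invr_gt0.
have v0 := sigma20 x; rewrite /sigma2_hat; move: (sigma2 x) v0 => v v0.
have [vs|sv] := ltP v s^-1.
  rewrite /= mulr0 add0r mulr1 ge_min lerDl; apply/orP; left.
  by rewrite mulr_ge0// ltW.
rewrite mulr0 addr0; have [_|vs] /= := leP v s.
  by rewrite mulr1 mulr0 addr0 ge_min sv.
by rewrite mulr0 add0r mulr1 ge_min lexx orbT.
Qed.

Lemma sigma2_hat_gt0 x : 0 < sigma2_hat s sigma2 x.
Proof. by apply: lt_le_trans (sigma2_hat_ge x); rewrite lt_min invr_gt0 s0. Qed.

Let c0 : 0 < Num.sqrt (2 * pi : R).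
Proof. by rewrite sqrtr_gt0 mulr_gt0// pi_gt0. Qed.

Lemma p_hat_gt0 x y : `|y| <= s -> 0 < p_hat s f sigma2 y x.
Proof.
move=> ys; rewrite /p_hat ys mulr1 mulr_gt0 ?expR_gt0//.
by rewrite invr_gt0 mulr_gt0// sqrtr_gt0 sigma2_hat_gt0.
Qed.

Lemma p_hat_out x y : s < `|y| -> p_hat s f sigma2 y x = 0.
Proof. by rewrite /p_hat ltNge => /negbTE ->; rewrite mulr0. Qed.

Lemma p_hat_le x y :
  p_hat s f sigma2 y x <= (Num.sqrt (2 * pi) * Num.sqrt (Num.min s^-1 s))^-1.
Proof.
have m0 : 0 < Num.min s^-1 s by rewrite lt_min invr_gt0 s0.
have sg := sigma2_hat_gt0 x.
rewrite /p_hat -[leRHS]mulr1; apply: ler_pM => //.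
- rewrite -[leRHS]mulr1; apply: ler_pM => //.
  + rewrite lef_pV2 ?posrE; try by rewrite mulr_gt0// sqrtr_gt0.
    by rewrite ler_pM2l// ler_wsqrtr// sigma2_hat_ge.
  + rewrite -expR0 ler_expR oppr_le0 mulr_ge0 ?sqr_ge0// invr_ge0.
    by rewrite mulr_ge0// ltW.
- by case: (`|y| <= s).
Qed.

Lemma p_hat_rand_out x z y : s < `|y| -> p_hat_rand s f sigma2 y x z = 0.
Proof.
move=> sy; rewrite /p_hat_rand p_hat_out// add0r.
by move: sy; rewrite ltNge => /negbTE ->; rewrite mulr0.
Qed.

Lemma p_hat_rand_gt0 x z y : 0 <= z -> `|y| <= s ->
  0 < p_hat_rand s f sigma2 y x z.
Proof.
by move=> z0 ys; rewrite /p_hat_rand ys mulr1 ltr_wpDr// p_hat_gt0.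
Qed.

Lemma p_hat_rand_le x z y u : 0 <= u -> z <= u -> p_hat_rand s f sigma2 y x z <=
  (Num.sqrt (2 * pi) * Num.sqrt (Num.min s^-1 s))^-1 + u.
Proof.
move=> u0 zu; rewrite /p_hat_rand; apply: lerD; first exact: p_hat_le.
by case: (`|y| <= s); rewrite ?mulr1// mulr0.
Qed.

(** A Gaussian density decreases with the distance to its centre, so a point
    between two others has at least the smaller of their two densities. *)
Lemma is_interval_superlevel x z t : 0 <= t ->
  is_interval [set y | t < p_hat_rand s f sigma2 y x z].
Proof.
move=> t0 a b /= ta tb y /andP[ay yb].
have inS c : t < p_hat_rand s f sigma2 c x z -> `|c| <= s.
  move=> tc; rewrite leNgt; apply/negP => /(p_hat_rand_out x z) c0'.
  by move: tc; rewrite c0' ltNge t0.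
have as' := inS _ ta; have bs := inS _ tb.
have ys : `|y| <= s.
  move: as' bs; rewrite !ler_norml => /andP[? _] /andP[_ ?].
  by apply/andP; split; [exact: le_trans ay|exact: le_trans yb _].
have mono c : `|c| <= s -> (y - f x) ^+ 2 <= (c - f x) ^+ 2 ->
    p_hat_rand s f sigma2 c x z <= p_hat_rand s f sigma2 y x z.
  move=> cs yc; rewrite /p_hat_rand /p_hat cs ys !mulr1 lerD2r.
  have sg := sigma2_hat_gt0 x.
  apply: ler_wpM2l; first by rewrite invr_ge0 mulr_ge0// sqrtr_ge0.
  rewrite ler_expR lerN2 ler_wpM2r// invr_ge0 mulr_ge0//.
  exact: ltW.
have [yf|fy] := leP y (f x).
  apply: (lt_le_trans ta); apply: mono => //.
  rewrite -[leLHS]sqrrN -[leRHS]sqrrN ler_sqr ?nnegrE; lra.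
by apply: (lt_le_trans tb); apply: mono => //; rewrite ler_sqr ?nnegrE; lra.
Qed.

End fixed.

Section measurability.
Context (d1 : measure_display) (T : measurableType d1).
Variables (f sigma2 : T -> d.-tuple R -> R).
Hypothesis sigma20 : forall S x, 0 <= sigma2 S x.
Hypothesis mf : measurable_fun setT (fun q : T * d.-tuple R => f q.1 q.2).
Hypothesis msigma2 :
  measurable_fun setT (fun q : T * d.-tuple R => sigma2 q.1 q.2).

Lemma measurable_sigma2_hat :
  measurable_fun setT
    (fun q : T * d.-tuple R => sigma2_hat s (sigma2 q.1) q.2).
Proof.
have mc c : measurable_fun setT (cst c : T * d.-tuple R -> R).
  exact: measurable_cst.
rewrite /sigma2_hat; apply: measurable_funD; first apply: measurable_funD.
- apply: measurable_funM => //; apply: measurable_bool_natr.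
  by apply: measurable_and; exact: measurable_fun_ler.
- apply: measurable_funM => //; apply: measurable_bool_natr.
  exact: measurable_fun_ltr.
- apply: measurable_funM => //; apply: measurable_bool_natr.
  exact: measurable_fun_ltr.
Qed.

Lemma measurable_p_hat :
  measurable_fun setT (fun q : T * d.-tuple R * R =>
    p_hat s (f q.1.1) (sigma2 q.1.1) q.2 q.1.2).
Proof.
have mc c : measurable_fun setT (cst c : T * d.-tuple R * R -> R).
  exact: measurable_cst.
have mfst : measurable_fun setT (fst : T * d.-tuple R * R -> T * d.-tuple R).
  exact: measurable_fst.
have msg := measurableT_comp measurable_sigma2_hat mfst.
have mff := measurableT_comp mf mfst.
have sg q := ltW (sigma2_hat_gt0 (sigma20 q.1) q.2).
rewrite /p_hat; apply: measurable_funM; first apply: measurable_funM.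
- apply: measurable_inv_ge0.
    by move=> q; rewrite mulr_ge0// sqrtr_ge0.
  apply: measurable_funM => //.
  have msqrt : measurable_fun setT (@Num.sqrt R).
    by apply: continuous_measurable_fun; exact: sqrt_continuous.
  exact: measurableT_comp msqrt msg.
- apply: measurableT_comp; first exact: measurable_expR.
  apply: measurable_funN; apply: measurable_funM.
    by apply: measurable_funX; apply: measurable_funB.
  apply: measurable_inv_ge0; last exact: measurable_funM.
  by move=> q; rewrite mulr_ge0//; exact: (sg q.1).
- apply: measurable_bool_natr; apply: measurable_fun_ler => //.
  exact: measurableT_comp.
Qed.

Lemma measurable_p_hat_rand :
  measurable_fun setT (fun q : T * (d.-tuple R * R) * R =>
    p_hat_rand s (f q.1.1) (sigma2 q.1.1) q.2 q.1.2.1 q.1.2.2).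
Proof.
rewrite /p_hat_rand; apply: measurable_funD.
  have mh : measurable_fun setT
      (fun q : T * (d.-tuple R * R) * R => ((q.1.1, q.1.2.1), q.2)).
    apply: measurable_fun_pair => //; apply: measurable_fun_pair.
      exact: measurableT_comp.
    by apply: measurableT_comp => //; exact: measurableT_comp.
  exact: measurableT_comp measurable_p_hat mh.
apply: measurable_funM.
  by apply: measurableT_comp => //; exact: measurableT_comp.
apply: measurable_bool_natr; apply: measurable_fun_ler => //.
exact: measurableT_comp.
Qed.

End measurability.

End p_hat_facts.

(** * The empirical length function *)

Section empirical_length.
Context (R : realType) (d M N : nat) (s l : R).
Variables (f sigma2 : d.-tuple R -> R).
Variables (x : 'I_N -> d.-tuple R) (z : 'I_N -> R).
Hypothesis s0 : 0 < s.
Hypothesis M1 : (1 < M)%N.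
Hypothesis N0 : (0 < N)%N.
Hypothesis l0 : 0 < l.
Hypothesis sigma20 : forall x, 0 <= sigma2 x.

Let p i y := p_hat_rand s f sigma2 y (x i) (z i).
Let G := G_hat s M f sigma2 x z.

Let c0 : 0 <= 2 * s / (M%:R * N%:R).
Proof. by rewrite divr_ge0// ?mulr_ge0// ltW. Qed.

Lemma G_hat_noninc r t : r <= t -> G t <= G r.
Proof.
move=> rt; rewrite /G /G_hat; apply: ler_wpM2l => //.
apply: ler_sum => k _; apply: ler_sum => i _.
rewrite ler_nat; have [tp|//] := boolP (t < _).
by rewrite (le_lt_trans rt tp).
Qed.

Lemma G_hat_eventually_le : exists2 t, 0 <= t & G t <= l.
Proof.
pose t := \sum_(k < M) \sum_(i < N) `|p i (grid s k)|.
exists t; first by apply: sumr_ge0 => k _; exact: sumr_ge0.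
suff -> : G t = 0 by exact: ltW.
rewrite /G /G_hat big1 ?mulr0// => k _; apply: big1 => i _.
suff : p i (grid s k) <= t by rewrite leNgt => /negbTE ->.
apply: (le_trans (ler_norm _)); rewrite /t (bigD1 k)//= (bigD1 i)//= -addrA.
by rewrite lerDl addr_ge0// sumr_ge0// => ? _; exact: sumr_ge0.
Qed.

(** All the sampled densities are positive, so [G_hat] keeps its maximal value
    [2 * s > l] up to the smallest of them.  A zero threshold would make the
    prediction region the whole line. *)
Lemma G_hat_quantile_gt0 : l < 2 * s -> (forall i, 0 <= z i) ->
  0 < generalized_inverse G l.
Proof.
move=> l2s z0.
(* The smallest sampled density; the initial value 1 only keeps it positive. *)
pose c := \big[Num.min/1]_(a : 'I_M * 'I_N) p a.2 (grid s a.1).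
have c_gt0 : 0 < c.
  rewrite /c; elim/big_ind : _ => //.
    by move=> a b a0 b0; rewrite lt_min a0.
  by move=> a _; apply: p_hat_rand_gt0 => //; exact: grid_norm.
apply: (lt_le_trans c_gt0); apply: lb_le_inf.
  by have [t t0 Gt] := G_hat_eventually_le; exists t.
move=> t [t0 Gt]; rewrite leNgt; apply/negP => tc.
suff Gt' : G t = 2 * s by move: Gt; rewrite Gt' leNgt l2s.
rewrite /G /G_hat.
rewrite (eq_bigr (fun=> N%:R)); last first.
  move=> k _; rewrite (eq_bigr (fun=> 1)) ?sumr_const ?card_ord// => i _.
  have -> // : t < p_hat_rand s f sigma2 (grid s k) (x i) (z i).
  apply: (lt_le_trans tc); exact: (bigmin_le _ (k, i)).
rewrite sumr_const card_ord -[N%:R *+ M]mulr_natl divfK//.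
by rewrite mulf_neq0// gt_eqF// ltr0n// ltnW.
Qed.

(** Exchanging the two sums turns [G_hat] into the mean over the sample of
    Riemann sums of intervals. *)
Lemma G_hat_near_mean_length t : 0 <= t ->
  `|G t - N%:R^-1 * \sum_(i < N) fine (superlevel_length (p i) t)|
    <= 2 * (2 * s / M.-1%:R).
Proof.
move=> t0.
have N0R : 0 < N%:R :> R by rewrite ltr0n.
have M0R : 0 < M%:R :> R by rewrite ltr0n ltnW.
pose cnt i := 2 * s / M%:R * \sum_(k < M) \1_[set y | t < p i y] (grid s k).
have -> : G t = N%:R^-1 * \sum_(i < N) cnt i.
  rewrite /G /G_hat exchange_big/= -mulr_sumr mulrA; congr (_ * _).
    by field; rewrite !gt_eqF.
  apply: eq_bigr => i _; apply: eq_bigr => k _; rewrite indicE.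
  congr ((nat_of_bool _)%:R).
  by apply/idP/idP => [?|/set_mem//]; exact/mem_set.
rewrite -mulrBr -sumrB normrM gtr0_norm ?invr_gt0// ler_pdivrMl//.
apply: (le_trans (ler_norm_sum _ _ _)).
apply: (@le_trans _ _ (\sum_(i < N) 2 * (2 * s / M.-1%:R))); last first.
  by rewrite sumr_const card_ord -[leLHS]mulr_natl.
apply: ler_sum => i _; apply: grid_count => //.
  exact: is_interval_superlevel.
move=> y /= ty; rewrite leNgt; apply/negP => sy.
by move: ty; rewrite /p p_hat_rand_out// ltNge t0.
Qed.

End empirical_length.

Lemma grid_step_le (R : realType) (s : R) (M N : nat) :
  0 < s -> (0 < N)%N -> 4 * Num.sqrt N%:R < M%:R :> R ->
  (1 < M)%N /\ 2 * (2 * s / M.-1%:R) <= 2 * s / Num.sqrt N%:R.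
Proof.
move=> s0 N0 NM.
have r1 : 1 <= Num.sqrt N%:R :> R.
  by rewrite -[leLHS]sqrtr1 ler_wsqrtr// ler1n.
have M4 : (4 < M)%N by rewrite -(ltr_nat R); lra.
have M1 : (1 < M)%N by exact: leq_trans M4.
split=> //.
have ME : M%:R = M.-1%:R + 1 :> R by rewrite natr1 prednK// ltnW.
have m0 : 0 < M.-1%:R :> R by lra.
rewrite mulrA ler_pdivrMr// mulrAC ler_pdivlMr; last by lra.
rewrite [2 * (2 * s)]mulrC -mulrA ler_pM2l ?mulr_gt0//.
lra.
Qed.

(** * Independence of the samples *)

Section data_independence.
Context (R : realType) (disp : measure_display) (Omega : measurableType disp).
Context (P : probability Omega R) (d n N : nat).
Variables (XY : {RV P >-> (d.-tuple R * R)%type}) (zeta : {RV P >-> R}).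
Variables (D : 'I_n -> {RV P >-> (d.-tuple R * R)%type}).
Variables (XN : 'I_N -> {RV P >-> d.-tuple R}) (zetaN : 'I_N -> {RV P >-> R}).
Hypothesis hind : mutually_independent P (data_sigma XY zeta D XN zetaN).

Let I := (unit + unit + 'I_n + 'I_N + 'I_N)%type.
Let F : I -> set (set Omega) := data_sigma XY zeta D XN zetaN.

Let preimage_measurable d1 (T1 : measurableType d1) (f : {RV P >-> T1}) :
  g_sigma_algebra_preimage f `<=` measurable.
Proof.
by move=> _ [B mB <-]; exact: (measurable_funPT f).
Qed.

Let preimage_setI d1 (T1 : measurableType d1) (f : {RV P >-> T1}) :
  setI_closed (g_sigma_algebra_preimage f).
Proof.
move=> _ _ [B mB <-] [B' mB' <-]; exists (B `&` B'); first exact: measurableI.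
by rewrite !setTI.
Qed.

Let preimage_setTm d1 (T1 : measurableType d1) (f : {RV P >-> T1}) :
  g_sigma_algebra_preimage f setT.
Proof. by exists setT; rewrite ?setTI. Qed.

Let Fm i : F i `<=` measurable.
Proof. by case: i => [[[[[]|[]]|i]|j]|j]; exact: preimage_measurable. Qed.

Let FI i : setI_closed (F i).
Proof. by case: i => [[[[[]|[]]|i]|j]|j]; exact: preimage_setI. Qed.

Let FT i : F i setT.
Proof. by case: i => [[[[[]|[]]|i]|j]|j]; exact: preimage_setTm. Qed.

Let ind (J K : {set I}) := @independent_joint_functions R disp Omega P I F
  Fm FI FT hind J K.

Let coord (J : {set I}) i d1 (T1 : measurableType d1) (f : Omega -> T1) :
  F i = g_sigma_algebra_preimage f -> i \in J ->
  measurable_fun (setT : set (g_sigma_algebraType (joint_events F J))) f.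
Proof.
move=> Fi iJ; apply: (measurable_joint_coord FT iJ) => U mU.
by rewrite Fi; exists U => //; rewrite setTI.
Qed.

Let ixy : I := inl (inl (inl (inl tt))).
Let iz : I := inl (inl (inl (inr tt))).
Let iD : {set I} := [set i : I | if i is inl (inl (inr _)) then true else false]%SET.
Let iX j : I := inl (inr j).
Let iZ j : I := inr j.

Lemma independent_fresh : independent2 P (fst \o XY) zeta.
Proof.
apply: (@ind [set ixy]%SET [set iz]%SET).
- by rewrite disjoints1 inE.
- apply: measurableT_comp => //; apply: (@coord _ ixy) => //; exact: set11.
- by apply: (@coord _ iz) => //; exact: set11.
Qed.

Lemma independent_unlabeled j : independent2 P (XN j) (zetaN j).
Proof.
apply: (@ind [set iX j]%SET [set iZ j]%SET).
- by rewrite disjoints1 inE.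
- by apply: (@coord _ (iX j)) => //; exact: set11.
- by apply: (@coord _ (iZ j)) => //; exact: set11.
Qed.

Let measurable_labeled (J : {set I}) : iD \subset J ->
  measurable_fun (setT : set (g_sigma_algebraType (joint_events F J)))
    (fun w => [tuple D i w | i < n]).
Proof.
move=> DJ; apply/measurable_fun_tnthP => i.
rewrite (_ : _ \o _ = D i); last by apply/funext => w /=; rewrite tnth_mktuple.
apply: (@coord _ (inl (inl (inr i)))) => //.
by apply: (fintype.subsetP DJ); rewrite inE.
Qed.

Let measurable_unlabeled (J : {set I}) j : iX j \in J -> iZ j \in J ->
  measurable_fun (setT : set (g_sigma_algebraType (joint_events F J)))
    (fun w => (XN j w, zetaN j w)).
Proof.
by move=> XJ ZJ; apply: measurable_fun_pair; [exact: (@coord _ (iX j))|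
  exact: (@coord _ (iZ j))].
Qed.

Lemma independent_labeled_unlabeled j :
  independent2 P (fun w => [tuple D i w | i < n]) (fun w => (XN j w, zetaN j w)).
Proof.
apply: (@ind iD [set iX j; iZ j]%SET).
- apply/pred0P => -[[[[[]|[]]|i]|k]|k]; rewrite !inE//.
- exact: measurable_labeled.
- by apply: measurable_unlabeled; rewrite !inE eqxx// orbT.
Qed.

(** The labeled sample is part of the first group, because the threshold and
    the density both depend on it. *)
Lemma independent_unlabeled2 j k : j != k ->
  independent2 P (fun w => ([tuple D i w | i < n], (XN j w, zetaN j w)))
    (fun w => (XN k w, zetaN k w)).
Proof.
move=> jk; apply: (@ind (iD :|: [set iX j; iZ j])%SET [set iX k; iZ k]%SET).
- apply/pred0P => -[[[[[]|[]]|i]|m]|m]; rewrite !inE//=.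
  + apply/negP => /andP[/orP[]/eqP// [mj] /orP[]/eqP// [mk]].
    by move: jk; rewrite -mj -mk eqxx.
  + apply/negP => /andP[/eqP[mj] /eqP[mk]].
    by move: jk; rewrite -mj -mk eqxx.
- apply: measurable_fun_pair.
    by apply: measurable_labeled; exact: finset.subsetUl.
  by apply: measurable_unlabeled; rewrite !inE eqxx ?orbT.
- by apply: measurable_unlabeled; rewrite !inE eqxx ?orbT.
Qed.

End data_independence.

(** * Mean length over the fresh pair *)

Lemma uniform_prob_out (R : realType) (u : R) (hu : 0 < u) (A : set R) :
  (forall y, A y -> ~~ (0 <= y <= u)) -> uniform_prob hu A = 0%E.
Proof.
move=> A0; rewrite /uniform_prob; apply: integral0_eq => y /A0.
by rewrite /uniform_pdf => /negbTE ->.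
Qed.

Section fresh_pair.
Context (R : realType) (disp : measure_display) (Omega : measurableType disp).
Context (P : probability Omega R) (d : nat) (s u : R).
Variables (X : Omega -> d.-tuple R) (zeta : Omega -> R).
Hypothesis s0 : 0 < s.
Hypothesis u0 : 0 < u.
Hypothesis mX : measurable_fun setT X.
Hypothesis mzeta : measurable_fun setT zeta.
Hypothesis indXz : independent2 P X zeta.
Hypothesis zeta_uniform : forall A : set R, measurable A ->
  pushforward P zeta A = uniform_prob u0 A.
Context (d1 : measure_display) (T : measurableType d1).
Variables (f sigma2 : T -> d.-tuple R -> R).
Hypothesis sigma20 : forall S x, 0 <= sigma2 S x.
Hypothesis mf : measurable_fun setT (fun q : T * d.-tuple R => f q.1 q.2).
Hypothesis msigma2 :
  measurable_fun setT (fun q : T * d.-tuple R => sigma2 q.1 q.2).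

(** The randomized density with its arguments grouped by source of randomness:
    the labeled sample, the pair of a feature and its noise, the point. *)
Definition noisy_density (S : T) (a : d.-tuple R * R) (y : R) : R :=
  p_hat_rand s (f S) (sigma2 S) y a.1 a.2.

Let q := noisy_density.
Let Z w := (X w, zeta w).

Lemma measurable_noisy_density :
  measurable_fun setT (fun a : T * (d.-tuple R * R) * R => q a.1.1 a.1.2 a.2).
Proof. exact: measurable_p_hat_rand. Qed.

Lemma noisy_density_out S a y : s < `|y| -> q S a y = 0.
Proof. exact: p_hat_rand_out. Qed.

Let mq1 S a : measurable_fun setT (q S a).
Proof.
exact: (@measurable_fun_section1 _ _ _ _ _ _
  (fun b : T * (d.-tuple R * R) => q b.1 b.2) measurable_noisy_density (S, a)).
Qed.

Lemma measurable_fresh_pair : measurable_fun setT Z.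
Proof. exact: measurable_fun_pair. Qed.

(** The uniform law on [0, u] has density at most [u^-1]. *)
Lemma mean_length_lipschitz S r t : 0 <= r -> r <= t ->
  (mean_length P q Z S r <= mean_length P q Z S t
     + (2 * s * u^-1 * (t - r))%:E)%E.
Proof.
move=> r0 rt.
pose fS x y := p_hat s (f S) (sigma2 S) y x.
have mfS : measurable_fun setT (fun a : d.-tuple R * R => fS a.1 a.2).
  have mh : measurable_fun setT (fun a : d.-tuple R * R => ((S, a.1), a.2)).
    apply: measurable_fun_pair => //; apply: measurable_fun_pair => //.
  exact: measurableT_comp (measurable_p_hat s0 sigma20 mf msigma2) mh.
apply: (@mean_superlevel_length_lipschitz R disp _ Omega _ P s u^-1 fS X zeta) => //.
- by rewrite invr_ge0 ltW.
- by move=> x y; exact: p_hat_out.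
- move=> a b ab; have -> : P (zeta @^-1` `]a, b]) = uniform_prob u0 `]a, b].
    by rewrite -zeta_uniform.
  exact: uniform_prob_itv_le.
Qed.

Lemma zeta_lt0_null : P (zeta @^-1` [set y | y < 0]) = 0%E.
Proof.
have -> : P (zeta @^-1` [set y | y < 0]) = uniform_prob u0 [set y | y < 0].
  by rewrite -zeta_uniform// -set_itvNyo.
by apply: uniform_prob_out => y /= y0; rewrite leNgt y0.
Qed.

Let zeta_gt_null : P (zeta @^-1` [set y | u < y]) = 0%E.
Proof.
have -> : P (zeta @^-1` [set y | u < y]) = uniform_prob u0 [set y | u < y].
  by rewrite -zeta_uniform// -set_itvoy.
by apply: uniform_prob_out => y /= y0; rewrite [y <= u]leNgt y0 andbF.
Qed.

Let mpre (A : set R) : measurable A -> measurable (zeta @^-1` A).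
Proof. by move=> mA; rewrite -[X in measurable X]setTI; exact: mzeta. Qed.

Lemma mean_length_top S : mean_length P q Z S 0 = (2 * s)%:E.
Proof.
apply/eqP; rewrite eq_le; apply/andP; split.
  apply: mean_length_le => //.
  - exact: measurable_noisy_density.
  - exact: noisy_density_out.
  - exact: measurable_fresh_pair.
rewrite -[leLHS]mule1 -(@probability_setT _ _ _ P) -integral_cst//.
apply: (ge0_le_integral_off_null (A := zeta @^-1` [set y | y < 0])).
- by apply: mpre; rewrite -set_itvNyo.
- exact: zeta_lt0_null.
- apply: measurable_superlevel_length_Z.
  + exact: measurable_noisy_density.
  + exact: measurable_fresh_pair.
- by move=> w; rewrite lee_fin mulr_ge0// ltW.
- by move=> w; exact: measure_ge0.
- move=> w /= /negP; rewrite -leNgt => zw.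
  rewrite -lebesgue_measure_norm_le// /superlevel_length; apply: le_measure; rewrite ?inE.
  + exact: measurable_norm_le.
  + exact: measurable_superlevel.
  + by move=> y /= ys; exact: p_hat_rand_gt0.
Qed.

Lemma mean_length_bottom S : exists2 t, 0 <= t & mean_length P q Z S t = 0%E.
Proof.
set b := (Num.sqrt (2 * pi) * Num.sqrt (Num.min s^-1 s))^-1.
have b0 : 0 <= b by rewrite invr_ge0 mulr_ge0// sqrtr_ge0.
exists (b + u); first by rewrite addr_ge0// ltW.
apply/eqP; rewrite eq_le mean_length_ge0 andbT.
rewrite -(@integral0 _ _ _ P setT).
apply: (ge0_le_integral_off_null (A := zeta @^-1` [set y | u < y])) => //.
- by apply: mpre; rewrite -set_itvoy.
- move=> w /= /negP; rewrite -leNgt => zw.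
  rewrite /superlevel_length (_ : [set _ | _] = set0) ?measure0//.
  apply/seteqP; split => // y /=; rewrite ltNge p_hat_rand_le//.
  exact: ltW.
Qed.

(** The noise leaves no atom: by the Lipschitz bound the mean lengths of the
    regions above thresholds [r < t] tend to that at [t], and the region with a
    weak inequality at [t] is contained in all of them. *)
Lemma expected_length_mean_length S t : 0 < t ->
  expected_length P X zeta (fun x z => [set y | t <= q S (x, z) y])
  = mean_length P q Z S t.
Proof.
move=> t0.
have mge w : measurable [set y | t <= q S (X w, zeta w) y].
  rewrite -[X in measurable X]setTI.
  have := @mq1 S (X w, zeta w) measurableT `[t, +oo[%classic (measurable_itv _).
  by rewrite set_itvcy.
have fin r : 0 <= r -> mean_length P q Z S r \is a fin_num.
  apply: (mean_length_fin P s0).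
  - exact: measurable_noisy_density.
  - exact: noisy_density_out.
  - exact: measurable_fresh_pair.
apply/eqP; rewrite eq_le; apply/andP; split; last first.
  apply: ge0_le_integral_nonmeasurable => w; first exact: measure_ge0.
  apply: le_measure; rewrite ?inE//; [exact: measurable_superlevel|exact: mge|].
  by move=> y /=; exact: ltW.
apply/lee_addgt0Pr => e e0.
have K0 : 0 < 2 * s * u^-1 + 1.
  by rewrite ltr_wpDl// mulr_ge0// ?invr_ge0 ?mulr_ge0// ltW.
(* Close enough below t for the Lipschitz bound to be at most e. *)
pose r := Num.max 0 (t - e / (2 * s * u^-1 + 1)).
have r0 : 0 <= r by rewrite le_max lexx.
have rt : r < t by rewrite gt_max t0 ltrBlDr ltrDl divr_gt0.
apply: (@le_trans _ _ (mean_length P q Z S r)).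
  apply: ge0_le_integral_nonmeasurable => w; first exact: measure_ge0.
  apply: le_measure; rewrite ?inE//; [exact: mge|exact: measurable_superlevel|].
  by move=> y /=; exact: lt_le_trans.
apply: (le_trans (mean_length_lipschitz S r0 (ltW rt))).
apply: leeD => //; rewrite lee_fin.
apply: (@le_trans _ _ (2 * s * u^-1 * (e / (2 * s * u^-1 + 1)))).
  apply: ler_wpM2l; first by rewrite mulr_ge0// ?invr_ge0 ?mulr_ge0// ltW.
  by rewrite lerBlDr -lerBlDl le_max lexx orbT.
by rewrite mulrCA ger_pMr// ler_pdivrMr// mul1r lerDl.
Qed.

End fresh_pair.

(** * Error of the empirical threshold *)

Section quantile_error.
Context (R : realType) (disp : measure_display) (Omega : measurableType disp).
Context (P : probability Omega R) (d M N : nat) (s u l : R).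
Variables (X : Omega -> d.-tuple R) (zeta : Omega -> R).
Hypothesis s0 : 0 < s.
Hypothesis u0 : 0 < u.
Hypothesis l0 : 0 < l.
Hypothesis l2s : l < 2 * s.
Hypothesis N0 : (0 < N)%N.
Hypothesis NM : 4 * Num.sqrt N%:R < M%:R :> R.
Hypothesis mX : measurable_fun setT X.
Hypothesis mzeta : measurable_fun setT zeta.
Hypothesis indXz : independent2 P X zeta.
Hypothesis zeta_uniform : forall A : set R, measurable A ->
  pushforward P zeta A = uniform_prob u0 A.
Context (d1 : measure_display) (T : measurableType d1).
Variables (f sigma2 : T -> d.-tuple R -> R).
Hypothesis sigma20 : forall S x, 0 <= sigma2 S x.
Hypothesis mf : measurable_fun setT (fun q : T * d.-tuple R => f q.1 q.2).
Hypothesis msigma2 :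
  measurable_fun setT (fun q : T * d.-tuple R => sigma2 q.1 q.2).

Let q := noisy_density s f sigma2.
Let Z w := (X w, zeta w).
Let m := mean_length P q Z.
Let tau := level P q Z.

Let tau_spec (v : R) S : 0 < v -> v < 2 * s ->
  [/\ 0 <= tau v S, m S (tau v S) = v%:E &
      forall c, 0 <= c -> (c < tau v S) = (v%:E < m S c)%E].
Proof.
apply: (@level_spec R _ _ _ Omega _ _ P s (2 * s * u^-1) q Z) => //.
- by rewrite mulr_ge0// ?invr_ge0 ?mulr_ge0// ltW.
- exact: measurable_noisy_density.
- exact: noisy_density_out.
- exact: measurable_fresh_pair.
- exact: mean_length_lipschitz.
- by apply: (mean_length_top s0 mX mzeta zeta_uniform).
- by apply: (mean_length_bottom X s0 mzeta zeta_uniform).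
Qed.

Section fixed_sample.
Variables (S : T) (x : 'I_N -> d.-tuple R) (z : 'I_N -> R).

Let G := G_hat s M (f S) (sigma2 S) x z.
Let t0 := generalized_inverse G l.

Definition mean_sample_length (v : R) : R :=
  N%:R^-1 * \sum_(i < N) fine (superlevel_length (q S (x i, z i)) (tau v S)).

(** Outside ]0, 2s[ the deviation is set to zero: the mean length stays in
    [0, 2s], so no such level is ever crossed. *)
Definition level_deviation (v : R) : R :=
  if (0 < v < 2 * s)%R then (mean_sample_length v - v) ^+ 2 else 0.

Lemma level_deviation_ge0 v : 0 <= level_deviation v.
Proof. by rewrite /level_deviation; case: ifP => // _; exact: sqr_ge0. Qed.

(** If the mean length at the empirical threshold
    [t0] exceeds [l + a], then [t0] lies below the threshold of level [l + a],
    where the empirical length is therefore at most [l] while its mean is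
    [l + a] up to the grid error.  Symmetrically, if the mean length is below
    [l - a], the empirical length at the threshold of level [l - a] exceeds
    [l].  As [a] is at least twice the grid error, one of the two sample means
    deviates by at least [a / 2]. *)
Lemma level_deviation_large (a : R) : 4 * s / Num.sqrt N%:R <= a ->
  0 <= t0 -> a < `|fine (m S t0) - l| ->
  1 <= 4 / a ^+ 2 * (level_deviation (l + a) + level_deviation (l - a)).
Proof.
move=> da t00 alt.
have [M1 step] := grid_step_le s0 N0 NM.
have r0 : 0 < Num.sqrt N%:R :> R by rewrite sqrtr_gt0 ltr0n.
have del0 : 0 < 4 * s / Num.sqrt N%:R by rewrite divr_gt0// mulr_gt0.
have a0 : 0 < a by exact: lt_le_trans da.
have near (v : R) : 0 < v -> v < 2 * s ->
    `|G (tau v S) - mean_sample_length v| <= a / 2.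
  move=> v0 v2s; have [tv0 _ _] := tau_spec S v0 v2s.
  have close : `|G (tau v S) - mean_sample_length v| <= 2 * (2 * s / M.-1%:R).
    by apply: G_hat_near_mean_length.
  apply: (le_trans close); apply: (le_trans step); rewrite ler_pdivlMr// (le_trans _ da)//.
  by rewrite le_eqVlt; apply/orP; left; apply/eqP; ring.
have mfin : m S t0 \is a fin_num.
  apply: (mean_length_fin P s0) => //.
  - exact: measurable_noisy_density.
  - exact: noisy_density_out.
  - exact: measurable_fresh_pair.
have [L mE] : exists L : R, m S t0 = L%:E by exists (fine (m S t0)); rewrite fineK.
rewrite mE /= in alt.
have m0 : 0 <= L by rewrite -lee_fin -mE mean_length_ge0.
have m2s : L <= 2 * s.
  rewrite -lee_fin -mE; apply: mean_length_le => //.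
  - exact: measurable_noisy_density.
  - exact: noisy_density_out.
  - exact: measurable_fresh_pair.
have Gnon r r' : 0 <= r -> r <= r' -> G r' <= G r.
  by move=> _; exact: G_hat_noninc.
have Gvan : exists2 t, 0 <= t & G t <= l by exact: G_hat_eventually_le.
have enough (v v' : R) : (0 < v < 2 * s)%R -> a / 2 <= `|mean_sample_length v - v| ->
    1 <= 4 / a ^+ 2 * (level_deviation v + level_deviation v').
  move=> hv dev.
  have dv : (a / 2) ^+ 2 <= level_deviation v.
    rewrite /level_deviation hv -[leRHS]real_normK ?num_real//.
    by rewrite ler_sqr ?nnegrE// divr_ge0// ltW.
  rewrite mulrAC ler_pdivlMr ?exprn_gt0// mul1r.
  have := level_deviation_ge0 v'.
  have -> : a ^+ 2 = 4 * (a / 2) ^+ 2 by field.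
  by move: dv; lra.
have [lm|ml] := leP l L.
  rewrite ger0_norm ?subr_ge0// in alt.
  have hv : (0 < l + a < 2 * s)%R.
    by rewrite addr_gt0//= addrC -ltrBrDr (lt_le_trans alt)// lerD2r.
  apply: enough => //.
  have /andP[v0 v2s] := hv.
  have [tv0 mtv lev] := tau_spec S v0 v2s.
  have tlt : t0 < tau (l + a) S by rewrite lev// mE lte_fin addrC -ltrBrDr.
  have Gl : G (tau (l + a) S) <= l by exact: generalized_inverse_gt tlt.
  have := near _ v0 v2s; rewrite ler_norml => /andP[n1 n2].
  by rewrite distrC; apply: le_trans (ler_norm _); lra.
rewrite ler0_norm ?subr_le0 ?(ltW ml)// in alt.
rewrite opprB in alt.
have hv : (0 < l - a < 2 * s)%R.
  rewrite subr_gt0 (lt_le_trans alt) ?gerBl//=.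
  by rewrite ltrBlDr (lt_trans l2s)// ltrDl.
rewrite [level_deviation _ + _]addrC; apply: enough => //.
have /andP[v0 v2s] := hv.
have [tv0 mtv lev] := tau_spec S v0 v2s.
have tlt : tau (l - a) S < t0.
  rewrite ltNge; apply/negP => tle.
  have : (m S (tau (l - a) S) <= m S t0)%E.
    apply: mean_length_noninc => //.
    - exact: measurable_noisy_density.
    - exact: measurable_fresh_pair.
  by rewrite mtv mE lee_fin lerBlDr -lerBlDl leNgt alt.
have Gl : l < G (tau (l - a) S).
  rewrite ltNge; apply/negP => /(generalized_inverse_le tv0).
  by rewrite leNgt tlt.
have := near _ v0 v2s; rewrite ler_norml => /andP[n1 n2].
by apply: le_trans (ler_norm _); lra.
Qed.

End fixed_sample.
End quantile_error.

(** * The bound *)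

Section dyadic_integral.
Context (R : realType) (disp : measure_display) (Omega : measurableType disp).
Variable P : probability Omega R.

Lemma sum_geometric_half (J : nat) :
  \sum_(j < J) (2 ^+ j)^-1 = 2 - 2 / 2 ^+ J :> R.
Proof.
elim: J => [|J IH]; first by rewrite big_ord0 expr0 divr1 subrr.
rewrite big_ord_recr/= IH exprS.
have : 2 ^+ J != 0 :> R by rewrite expf_neq0.
by move: (2 ^+ J) => x x0; field.
Qed.

(** With Chebyshev weights [4 / a^2] at the level [a = delta * 2^j], the terms
    form a geometric series of ratio [1 / 2]. *)
Lemma dyadic_integral (V : R -> Omega -> R) (B l delta : R) (J : nat) :
  0 < delta -> 0 <= B -> (forall v w, 0 <= V v w) ->
  (forall v, measurable_fun setT (V v)) ->
  (forall v, \int[P]_w (V v w)%:E <= B%:E)%E ->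
  (\int[P]_w (delta + \sum_(j < J) delta * 2 ^+ j *
      (4 / (delta * 2 ^+ j) ^+ 2
        * (V (l + delta * 2 ^+ j) w + V (l - delta * 2 ^+ j) w)))%:E
    <= (delta + 16 * B / delta)%:E)%E.
Proof.
move=> d0 B0 V0 mV IV.
pose a (j : 'I_J) : R := delta * 2 ^+ j.
have a0 j : 0 < a j by rewrite mulr_gt0// exprn_gt0.
have c0 j : 0 <= 4 / a j by rewrite divr_ge0// ltW.
pose U (j : 'I_J) w := V (l + a j) w + V (l - a j) w.
have U0 j w : 0 <= U j w by rewrite addr_ge0.
have mU j : measurable_fun setT (U j) by exact: measurable_funD.
have IU j : (\int[P]_w (U j w)%:E <= (2 * B)%:E)%E.
  rewrite (eq_integral (fun w => (V (l + a j) w)%:E + (V (l - a j) w)%:E)%E)//.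
  rewrite ge0_integralD//; last 4 first.
  - by move=> w _; rewrite lee_fin.
  - exact/measurable_EFinP.
  - by move=> w _; rewrite lee_fin.
  - exact/measurable_EFinP.
  by rewrite mulr_natl mulr2n EFinD leeD.
rewrite (eq_integral (fun w => delta%:E +
    \sum_(j < J) ((4 / a j)%:E * (U j w)%:E))%E); last first.
  move=> w _; rewrite EFinD -sumEFin; congr (_ + _)%E; apply: eq_bigr => j _.
  rewrite -EFinM; congr (_%:E); rewrite mulrA -/(a j); congr (_ * _).
  by field; rewrite gt_eqF.
have mt j : measurable_fun setT (fun w => (4 / a j)%:E * (U j w)%:E)%E.
  by apply: emeasurable_funM => //; exact/measurable_EFinP.
have t0 j w : (0 <= (4 / a j)%:E * (U j w)%:E)%E by rewrite -EFinM lee_fin mulr_ge0.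
rewrite ge0_integralD//; last 3 first.
- by move=> w _; rewrite lee_fin ltW.
- by move=> w _; apply: sume_ge0 => j _.
- exact: emeasurable_sum.
rewrite integral_cst//= probability_setT mule1 EFinD; apply: leeD => //.
rewrite ge0_integral_sum//.
apply: (@le_trans _ _ (\sum_(j < J) (8 * B / delta * (2 ^+ j)^-1)%:E)%E).
  apply: lee_sum => j _; rewrite ge0_integralZl//=; last 3 first.
  - exact/measurable_EFinP.
  - by move=> w _; rewrite lee_fin.
  - by rewrite lee_fin.
  apply: (@le_trans _ _ ((4 / a j)%:E * (2 * B)%:E)%E).
    by apply: lee_wpmul2l; rewrite ?lee_fin.
  rewrite -EFinM lee_fin le_eqVlt; apply/orP; left; apply/eqP.
  rewrite /a; have : 2 ^+ j != 0 :> R by rewrite expf_neq0.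
  by move: (2 ^+ j) => y y0; field; rewrite y0 gt_eqF.
rewrite sumEFin lee_fin -mulr_sumr sum_geometric_half.
apply: (@le_trans _ _ (8 * B / delta * 2)).
  apply: ler_wpM2l; first by rewrite divr_ge0 ?mulr_ge0// ltW.
  by rewrite gerBl divr_ge0// exprn_ge0.
by rewrite le_eqVlt; apply/orP; left; apply/eqP; field; rewrite gt_eqF.
Qed.

End dyadic_integral.

Theorem proposition3 (R : realType) :
  exists C : R, 0 < C /\
  forall (disp : measure_display) (Omega : measurableType disp)
    (P : probability Omega R) (d n N M : nat) (s u l : R)
    (XY : {RV P >-> (d.-tuple R * R)%type}) (zeta : {RV P >-> R})
    (D : 'I_n -> {RV P >-> (d.-tuple R * R)%type})
    (XN : 'I_N -> {RV P >-> d.-tuple R}) (zetaN : 'I_N -> {RV P >-> R})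
    (f_hat sigma2_tilde : n.-tuple (d.-tuple R * R) -> d.-tuple R -> R)
    (hs : 0 < s) (hu : 0 < u) (hl : 0 < l) (hls : l < 2 * s)
    (hN : (0 < N)%N) (hM : 4 * Num.sqrt (N%:R) < M%:R :> R)
    (hf : measurable_fun setT
       (fun q : n.-tuple (d.-tuple R * R) * d.-tuple R => f_hat q.1 q.2))
    (hsigma : measurable_fun setT
       (fun q : n.-tuple (d.-tuple R * R) * d.-tuple R =>
          sigma2_tilde q.1 q.2))
    (hsigma0 : forall S x, 0 <= sigma2_tilde S x)
    (hD : forall i, same_law P (D i) XY)
    (hXN : forall j, same_law P (XN j) (fst \o XY))
    (hzeta : forall A : set R, measurable A ->
       pushforward P zeta A = uniform_prob hu A)
    (hzetaN : forall j, same_law P (zetaN j) zeta)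
    (hind : mutually_independent P (data_sigma XY zeta D XN zetaN)),
  let Dn (w : Omega) := [tuple D i w | i < n] in
  let Gamma (w : Omega) :=
    Gamma_hat s M (f_hat (Dn w)) (sigma2_tilde (Dn w))
      (fun j => XN j w) (fun j => zetaN j w) l in
  (\int[P]_w `|expected_length P (fst \o XY) zeta (Gamma w) - l%:E|
    <= (C * (s / Num.sqrt (N%:R)))%:E)%E.
Proof.
exists 20; split; first by rewrite ltr0n.
move=> disp Omega P d n N M s u l XY zeta D XN zetaN f_hat
  sigma2_tilde hs hu hl hls hN hM hf hsigma hsigma0 _ hXN hzeta hzetaN hind.
pose Dn w := [tuple D i w | i < n].
pose Gamma w := Gamma_hat s M (f_hat (Dn w)) (sigma2_tilde (Dn w))
  (fun j => XN j w) (fun j => zetaN j w) l.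
suff : (\int[P]_w `|expected_length P (fst \o XY) zeta (Gamma w) - l%:E|
    <= (20 * (s / Num.sqrt N%:R))%:E)%E by [].
pose q := noisy_density s f_hat sigma2_tilde.
pose X := fst \o XY.
pose Z w := (X w, zeta w).
pose Zs j w := (XN j w, zetaN j w).
have r0 : 0 < Num.sqrt N%:R :> R by rewrite sqrtr_gt0 ltr0n.
have mX : measurable_fun setT X by exact: measurableT_comp.
have mz : measurable_fun setT zeta by exact: measurable_funPT.
have mW : measurable_fun setT Dn.
  apply/measurable_fun_tnthP => i.
  by rewrite (_ : _ \o _ = D i)//; apply/funext => w /=; rewrite tnth_mktuple.
have mZs j : measurable_fun setT (Zs j) by exact: measurable_fun_pair.
have indXz : independent2 P X zeta by exact: independent_fresh hind.
have lawZ j : same_law P (Zs j) Z.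
  apply: same_law_pair => //; exact: independent_unlabeled hind j.
have mq : measurable_fun setT
    (fun a : n.-tuple (d.-tuple R * R) * (d.-tuple R * R) * R =>
       q a.1.1 a.1.2 a.2).
  exact: measurable_noisy_density.
have q0 S a y : s < `|y| -> q S a y = 0 by exact: noisy_density_out.
have mZ : measurable_fun setT Z by exact: measurable_fresh_pair.
(* Twice the grid error, and the order of the standard deviation. *)
pose delta := 4 * s / Num.sqrt N%:R.
have d0 : 0 < delta by rewrite divr_gt0// mulr_gt0.
pose V v w := level_deviation P s X zeta f_hat sigma2_tilde (Dn w)
  (fun j => XN j w) (fun j => zetaN j w) v.
have V0 v w : 0 <= V v w by exact: level_deviation_ge0.
have K0 : 0 <= 2 * s * u^-1 by rewrite mulr_ge0// ?invr_ge0 ?mulr_ge0// ltW.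
have mlip S r t : 0 <= r -> r <= t -> (mean_length P q Z S r <=
    mean_length P q Z S t + (2 * s * u^-1 * (t - r))%:E)%E.
  exact: (mean_length_lipschitz hs mX mz indXz hzeta hsigma0 hf hsigma).
have mtop := mean_length_top hs mX mz hzeta hsigma0 hf hsigma.
have mbot := mean_length_bottom X hs mz hzeta f_hat hsigma0.
have mV v : measurable_fun setT (V v).
  rewrite /V /level_deviation; case hv : (0 < v < 2 * s)%R; last exact: measurable_cst.
  have /andP[v0 v2s] := hv.
  apply: measurable_funX; apply: measurable_funB; last exact: measurable_cst.
  apply: measurable_sample_mean => i.
  exact: (measurable_sample_length hs K0 mq q0 mZ mlip mtop mbot mW mZs v0 v2s i).
have IV v : (\int[P]_w (V v w)%:E <= ((2 * s) ^+ 2 / N%:R)%:E)%E.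
  rewrite /V /level_deviation; case hv : (0 < v < 2 * s)%R; last first.
    by rewrite integral0 lee_fin divr_ge0// sqr_ge0.
  have /andP[v0 v2s] := hv.
  apply: (level_second_moment hs K0 mq q0 mZ mlip mtop mbot hN mW mZs lawZ _ _ v0 v2s).
  - exact: independent_labeled_unlabeled hind.
  - exact: independent_unlabeled2 hind.
have B0 : 0 <= (2 * s) ^+ 2 / N%:R by rewrite divr_ge0// sqr_ge0.
have -> : 20 * (s / Num.sqrt N%:R) = delta + 16 * ((2 * s) ^+ 2 / N%:R) / delta.
  have NE : N%:R = Num.sqrt N%:R ^+ 2 :> R by rewrite sqr_sqrtr.
  rewrite /delta; move: r0 NE; move: (Num.sqrt N%:R) => r rp ->.
  by field; rewrite !gt_eqF.
apply: le_trans (dyadic_integral l N d0 B0 V0 mV IV).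
(* Negative noise has probability zero; without it the empirical threshold is
   positive. *)
pose neg j := zetaN j @^-1` [set y | y < 0].
have mlt0 : measurable [set y : R | y < 0] by rewrite -set_itvNyo.
have mneg j : measurable (neg j).
  by rewrite /neg -[X in measurable X]setTI; exact: (measurable_funPT (zetaN j)).
have neg0 j : P (neg j) = 0%E.
  rewrite -[LHS]/(pushforward P (zetaN j) _) hzetaN//.
  exact: (zeta_lt0_null hzeta).
pose null := \big[setU/set0]_(j < N) neg j.
have [mnull null0] : measurable null /\ P null = 0%E.
  apply: (big_ind (fun A => measurable A /\ P A = 0%E)) => //.
  move=> A B [mA A0] [mB B0']; split; first exact: measurableU.
  apply/eqP; rewrite eq_le measure_ge0 andbT.
  apply: (le_trans (measureU2 _ mA mB)).
  by rewrite -[leLHS]/(P A + P B)%E A0 B0' adde0.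
apply: (ge0_le_integral_off_null mnull null0).
- apply/measurable_EFinP; apply: measurable_funD; first exact: measurable_cst.
  apply: measurable_sum => j; apply: measurable_funM; first exact: measurable_cst.
  apply: measurable_funM; first exact: measurable_cst.
  exact: measurable_funD.
- by move=> w; exact: abse_ge0.
- move=> w; rewrite lee_fin; apply: addr_ge0; first exact: ltW.
  apply: sumr_ge0 => j _.
  by rewrite ?(mulr_ge0, addr_ge0, invr_ge0, exprn_ge0)// ltW.
- move=> w nw.
  have z0 j : 0 <= zetaN j w.
    rewrite leNgt; apply/negP => zj; apply: nw.
    by rewrite /null -bigcup_seq; exists j => //=; exact: mem_index_enum.
  have [M1 _] := grid_step_le hs hN hM.
  pose t0 := generalized_inverse (G_hat s M (f_hat (Dn w)) (sigma2_tilde (Dn w))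
    (fun j => XN j w) (fun j => zetaN j w)) l.
  have t0_gt0 : 0 < t0 by exact: G_hat_quantile_gt0.
  rewrite -[expected_length _ _ _ _]/(expected_length P X zeta
    (fun x z => [set y | t0 <= q (Dn w) (x, z) y])).
  rewrite (expected_length_mean_length hs mX mz indXz hzeta hsigma0 hf hsigma)//.
  have mfin := mean_length_fin P hs mq q0 mZ (Dn w) (ltW t0_gt0).
  rewrite -[X in (X - _)%E]fineK// -EFinB abse_EFin lee_fin.
  pose dev j := 4 / (delta * 2 ^+ j) ^+ 2
    * (V (l + delta * 2 ^+ j) w + V (l - delta * 2 ^+ j) w).
  have dj0 j : 0 < delta * 2 ^+ j by rewrite mulr_gt0// exprn_gt0.
  apply: (dyadic_bound (q := dev)).
  + exact: ltW.
  + by move=> j; rewrite /dev mulr_ge0 ?divr_ge0 ?exprn_ge0 ?addr_ge0// ltW.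
  + move=> j.
    apply: (level_deviation_large hs hl hls hN hM mX mz indXz hzeta hsigma0 hf
      hsigma _ (ltW t0_gt0)).
    by rewrite ler_peMr ?exprn_ege1 ?ler1n// ltW.
  + (* N dyadic levels suffice: delta * 2^N is at least 2 s, as sqrt N <= 2^N. *)
    have L0 : 0 <= fine (mean_length P q Z (Dn w) t0).
      by rewrite fine_ge0// mean_length_ge0.
    have L2s : fine (mean_length P q Z (Dn w) t0) <= 2 * s.
      by rewrite -lee_fin fineK//; apply: (mean_length_le P hs mq q0 mZ); exact: ltW.
    apply: (@le_trans _ _ (2 * s)).
      by rewrite ler_norml; apply/andP; split; lra.
    have rN : Num.sqrt N%:R <= 2 ^+ N :> R.
      apply: (@le_trans _ _ N%:R).
        rewrite -[leRHS]sqr_sqrtr// expr2 ler_peMr ?sqrtr_ge0//.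
        by rewrite -[leLHS]sqrtr1 ler_wsqrtr// ler1n.
      by rewrite -natrX ler_nat ltnW// ltn_expl.
    rewrite /delta mulrAC ler_pdivlMr//.
    apply: ler_pM => //; rewrite ?mulr_ge0 ?ltW//.
    by rewrite ltr_pM2r// ltr_nat.
Qed.
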